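(* Let $n\ge0$ and let $Q\subset\mathbb P^{n+1}_K$ be a smooth quadric defined by a quadratic form $f(X_0,\dots,X_{n+1})$ over a number field $K$, and let $m\in\mathbb Z_{\ge2}$. Let $Q_m$ be the $\mathbb Q$-divisor $(1-1/m)Q$ on $\mathbb P^{n+1}$. Let $S$ be a finite set of places of $K$ containing all archimedean places, and take the $\mathcal O_S$-model $(\mathbb P^{n+1}_{\mathcal O_S},\mathcal Q_m)$ of $(\mathbb P^{n+1},Q_m)$. If $m$ is even, then the set of Darmon points $(\mathbb P^{n+1}_{\mathcal O_S},\mathcal Q_m)^{D}(\mathcal O_S)$ is thin (as a subset of $\mathbb P^{n+1}(K)$).
   Context: $\mathcal Q$ is the Zariski closure of $Q$ in $\mathbb P^{n+1}_{\mathcal O_S}$ and $\mathcal Q_m=(1-1/m)\mathcal Q$. For $v\notin S$, with $\mathcal O_v\subset K_v$ the valuation ring and $\pi_v$ a uniformiser, and $P\in\mathbb P^{n+1}(K_v)$ with induced $\mathcal P\in\mathbb P^{n+1}(\mathcal O_v)$: $n_v(\mathcal Q,P)=\infty$ if $P\in Q$, and otherwise $n_v(\mathcal Q,P)=r$ where the scheme-theoretic intersection of $\mathcal P$ and $\mathcal Q$ is $\mathrm{Spec}\,\mathcal O_v/(\pi_v^r)$. The set of Darmon points $(\mathbb P^{n+1}_{\mathcal O_S},\mathcal Q_m)^{D}(\mathcal O_S)$ is the set of $P\in\mathbb P^{n+1}(K)$ such that $m\mid n_v(\mathcal Q,P)$ for all $v\notin S$ ($\infty$ counts as divisible by $m$).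 A subset of $X(K)$, for $X$ an integral variety over $K$, is thin if it is contained in a finite union of subsets each of which is either of the form $Z(K)$ with $Z\subsetneq X$ a proper Zariski-closed subset, or of the form $\pi(Y(K))$ with $Y$ an integral variety over $K$ with $\dim Y=\dim X$ and $\pi:Y\to X$ a generically finite dominant morphism of degree at least $2$. *)

(* Defs.v *)
From HB Require Import structures.
From Stdlib Require Import List.
From mathcomp Require Import all_boot all_order all_algebra all_field.
From mathcomp Require Import mpoly.

Set Implicit Arguments.
Unset Strict Implicit.
Unset Printing Implicit Defensive.
Import Order.TTheory GRing.Theory Num.Theory.
Local Open Scope ring_scope.

(** * Places of a number field

    Number fields are objects of type [fieldExtType rat].  A non-archimedean
    place is a normalised discrete valuation; an archimedean place is a complex
    embedding up to conjugation (embeddings into [algC] are the same thing as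
    embeddings into the complex numbers). *)

(* [dval v 0] is a junk value: all uses go through [val_ge], for which
   the valuation of 0 is infinite. *)
Record dvaluation (K : fieldType) := DValuation {
  dval : K -> int;
  dvalM : forall x y, x != 0 -> y != 0 -> dval (x * y) = dval x + dval y;
  dvalD : forall x y, x != 0 -> y != 0 -> x + y != 0 ->
    Num.min (dval x) (dval y) <= dval (x + y);
  dval_normalised : exists2 x, x != 0 & dval x = 1
}.

Definition val_ge (K : fieldType) (v : dvaluation K) (r : int) (x : K) : Prop :=
  x = 0 \/ r <= dval v x.

Definition in_Ov (K : fieldType) (v : dvaluation K) : K -> Prop := val_ge v 0.

Definition uniformiser (K : fieldType) (v : dvaluation K) (pi : K) : Prop :=
  pi != 0 /\ dval v pi = 1.

Inductive place (K : fieldExtType rat) : Type :=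
| FinitePlace of dvaluation K
| ArchimedeanPlace of {rmorphism K -> algC}.

Definition same_place (K : fieldExtType rat) (v w : place K) : Prop :=
  match v, w with
  | FinitePlace v, FinitePlace w => forall x, x != 0 -> dval v x = dval w x
  | ArchimedeanPlace s, ArchimedeanPlace t =>
      (forall x, s x = t x) \/ (forall x, s x = (t x)^*)
  | _, _ => False
  end.

(* Finite sets of places are represented by lists, up to [same_place]. *)
Definition in_places (K : fieldExtType rat) (v : place K) (S : seq (place K))
  : Prop := List.Exists (same_place v) S.

Definition contains_archimedean (K : fieldExtType rat) (S : seq (place K))
  : Prop := forall s : {rmorphism K -> algC}, in_places (ArchimedeanPlace s) S.

Definition in_OS (K : fieldExtType rat) (S : seq (place K)) (a : K) : Prop :=
  forall v : dvaluation K, ~ in_places (FinitePlace v) S -> in_Ov v a.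

(** * Smooth quadrics

    Points of P^N(K) are given by nonzero coordinate vectors; every predicate
    on points below is invariant under scaling. *)

(* Jacobian criterion, for points with values in arbitrary field extensions. *)
Definition smooth_hypersurface (K : fieldType) (N : nat)
    (f : {mpoly K[N.+1]}) : Prop :=
  forall (L : fieldType) (iota : {rmorphism K -> L}) (x : 'I_N.+1 -> L),
    (exists i, x i != 0) -> mmap iota x f = 0 ->
    exists i, mmap iota x (f^`M(i)) != 0.

Definition smooth_quadric (K : fieldType) (N : nat) (f : {mpoly K[N.+1]})
  : Prop := f \is 2.-homog /\ smooth_hypersurface f.

(** * Darmon points *)

(* The degree-[d] part of the homogeneous ideal f K[X] /\ O_S[X], which defines
   the Zariski closure of Q = (f = 0) in projective space over O_S. *)
Definition closure_form (K : fieldExtType rat) (N : nat) (S : seq (place K))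
    (f : {mpoly K[N.+1]}) (d : nat) (g : {mpoly K[N.+1]}) : Prop :=
  [/\ g \is d.-homog,
      forall mon : 'X_{1..N.+1}, in_OS S g@_mon
    & exists h : {mpoly K[N.+1]}, g = h * f].

Definition primitive_coordinates (K : fieldType) (N : nat) (v : dvaluation K)
    (x : 'rV[K]_N.+1) : Prop :=
  (forall i, in_Ov v (x 0 i)) /\ (exists i, x 0 i != 0 /\ dval v (x 0 i) = 0).

(* The ideal of O_v obtained by pulling back the ideal of the closure of Q along
   the section Spec O_v -> P^N with primitive coordinates [x]; it cuts out the
   scheme-theoretic intersection of that section with the closure of Q. *)
Definition intersection_ideal (K : fieldExtType rat) (N : nat)
    (S : seq (place K)) (f : {mpoly K[N.+1]}) (v : dvaluation K)
    (x : 'rV[K]_N.+1) (a : K) : Prop :=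
  exists s : seq (K * {mpoly K[N.+1]}),
    List.Forall (fun u => in_Ov v u.1 /\ exists d, closure_form S f d u.2) s
    /\ a = \sum_(u <- s) u.1 * (u.2).@[x 0].

(* [intersection_number S f v x r] says n_v(Q, [x]) = r, with [None] standing
   for infinity.  As [x] has coordinates in K, the localisation of O_K at v is
   used in place of its completion; the quotient by (pi_v^r) is the same. *)
Definition intersection_number (K : fieldExtType rat) (N : nat)
    (S : seq (place K)) (f : {mpoly K[N.+1]}) (v : dvaluation K)
    (x : 'rV[K]_N.+1) (r : option nat) : Prop :=
  match r with
  | None => f.@[x 0] = 0
  | Some r =>
      f.@[x 0] != 0 /\
      exists (c pi : K),
        [/\ c != 0, primitive_coordinates v (c *: x), uniformiser v pi
          & forall a, intersection_ideal S f v (c *: x) a <->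
              exists2 b, in_Ov v b & a = b * pi ^+ r]
  end.

Definition dvdn_inf (m : nat) (r : option nat) : Prop :=
  match r with None => True | Some r => (m %| r)%N end.

Definition darmon_point (K : fieldExtType rat) (N : nat) (S : seq (place K))
    (f : {mpoly K[N.+1]}) (m : nat) (x : 'rV[K]_N.+1) : Prop :=
  x != 0 /\
  forall v : dvaluation K, ~ in_places (FinitePlace v) S ->
    exists2 r, intersection_number S f v x r & dvdn_inf m r.

(** * Integral varieties

    An integral variety over K (integral separated K-scheme of finite type) is
    described, following Chevalley, inside its function field L: it has a finite
    affine open cover by the spectra of finitely generated K-subalgebras of L
    with fraction field L, two points being identified when their local rings
    are the same subring of L. *)

Section Subalgebras.
Variables (K L : fieldType) (iota : {rmorphism K -> L}).
Implicit Types (A p : L -> Prop).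

(* The subalgebra K[g_0, ..., g_(k-1)] of L. *)
Definition gen_alg (g : seq L) (z : L) : Prop :=
  exists F : {mpoly K[size g]}, z = mmap iota (fun i => g`_i) F.

Definition prime_of A p : Prop :=
  [/\ forall a, p a -> A a,
      p 0 /\ ~ p 1,
      forall a b, p a -> p b -> p (a + b),
      forall a b, A a -> p b -> p (a * b)
    & forall a b, A a -> A b -> p (a * b) -> p a \/ p b].

(* The localisation of A at p, as a subring of L. *)
Definition local_ring A p (z : L) : Prop :=
  exists a b, [/\ A a, A b, ~ p b & z = a / b].

Definition local_max A p (z : L) : Prop :=
  exists a b, [/\ A a /\ p a, A b, ~ p b & z = a / b].

Definition rational_prime A p : Prop :=
  forall a, A a -> exists c : K, p (a - iota c).

Definition alg_indep (d : nat) (z : 'I_d -> L) : Prop :=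
  forall F : {mpoly K[d]}, mmap iota z F = 0 -> F = 0.

Definition trdeg_is (d : nat) : Prop :=
  exists z : 'I_d -> L, alg_indep z /\
    forall y : L, exists2 F : {poly {mpoly K[d]}},
      F != 0 & (map_poly (mmap iota z) F).[y] = 0.

(* F is meant to be a subfield of L. *)
Definition ext_degree (F : L -> Prop) (d : nat) : Prop :=
  exists e : 'I_d -> L,
    (forall z, exists2 c : 'I_d -> L,
       forall i, F (c i) & z = \sum_i c i * e i) /\
    (forall c : 'I_d -> L,
       (forall i, F (c i)) -> \sum_i c i * e i = 0 -> forall i, c i = 0).

End Subalgebras.

(* [vcharts] lists finite generating families of the coordinate rings of the
   charts.  [vglue] says that, for two charts with rings A and B, the natural
   maps from Spec of the compositum A.B to Spec A and Spec B are open immersions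
   having the same image in terms of local rings: it expresses both the
   compatibility of the charts and separatedness. *)
Record variety (K : fieldType) := Variety {
  vfield : fieldType;
  vin : {rmorphism K -> vfield};
  vcharts : seq (seq vfield);
  vnonempty : vcharts <> [::];
  vfrac : forall g, g \in vcharts -> forall z, exists a b,
    [/\ gen_alg vin g a, gen_alg vin g b, b != 0 & z = a / b];
  vglue : forall g h, g \in vcharts -> h \in vcharts ->
    forall q, prime_of (gen_alg vin (g ++ h)) q ->
    forall z, local_ring (gen_alg vin g) q z <-> local_ring (gen_alg vin h) q z
}.

Definition variety_dim (K : fieldType) (Y : variety K) (d : nat) : Prop :=
  trdeg_is (vin Y) d.

(** * Morphisms to projective space

    A morphism from an integral variety Y to P^N is given by its value at the
    generic point, a point [t] of P^N over the function field of Y, which has to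
    be regular at every point of Y. *)

Section Morphisms.
Variables (K : fieldType) (Y : variety K) (N : nat).
Variable t : 'I_N.+1 -> vfield Y.

Definition morphism_to_proj : Prop :=
  forall g p, g \in vcharts Y -> prime_of (gen_alg (vin Y) g) p ->
  exists l : vfield Y,
    [/\ l != 0,
        forall k, local_ring (gen_alg (vin Y) g) p (l * t k)
      & exists k, ~ local_max (gen_alg (vin Y) g) p (l * t k)].

(* The generic point of Y is mapped to the generic point of P^N. *)
Definition dominant_to_proj : Prop :=
  forall d (G : {mpoly K[N.+1]}), G \is d.-homog -> G != 0 ->
    mmap (vin Y) t G != 0.

(* The image of the function field of P^N in that of Y. *)
Definition pullback_field (z : vfield Y) : Prop :=
  exists d (G H : {mpoly K[N.+1]}),
    [/\ G \is d.-homog, H \is d.-homog, mmap (vin Y) t H != 0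
      & z = mmap (vin Y) t G / mmap (vin Y) t H].

(* [x] is the image of some K-rational point of Y. *)
Definition image_of_rational_points (x : 'rV[K]_N.+1) : Prop :=
  exists g p,
    [/\ g \in vcharts Y, prime_of (gen_alg (vin Y) g) p,
        rational_prime (vin Y) (gen_alg (vin Y) g) p
      & exists2 l : vfield Y, l != 0 &
          forall k, local_max (gen_alg (vin Y) g) p (l * t k - vin Y (x 0 k))].

End Morphisms.

(** * Thin subsets of P^N(K) *)

(* As P^N is integral, a closed subset given by homogeneous equations is proper
   if and only if one of the equations is nonzero. *)
Definition proper_closed_piece (K : fieldType) (N : nat)
    (Z : 'rV[K]_N.+1 -> Prop) : Prop :=
  exists hs : seq {mpoly K[N.+1]},
    [/\ forall h, h \in hs -> exists d, h \is d.-homog,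
        exists2 h, h \in hs & h != 0
      & forall x, x != 0 -> (Z x <-> forall h, h \in hs -> h.@[x 0] = 0)].

Definition cover_piece (K : fieldType) (N : nat)
    (Z : 'rV[K]_N.+1 -> Prop) : Prop :=
  exists (Y : variety K) (t : 'I_N.+1 -> vfield Y),
    [/\ variety_dim Y N, morphism_to_proj t, dominant_to_proj t,
        exists2 d, ext_degree (pullback_field t) d & (2 <= d)%N
      & forall x, x != 0 -> (Z x <-> image_of_rational_points t x)].

Definition thin (K : fieldType) (N : nat) (T : 'rV[K]_N.+1 -> Prop) : Prop :=
  exists pieces : seq ('rV[K]_N.+1 -> Prop),
    List.Forall (fun Z => proper_closed_piece Z \/ cover_piece Z) pieces /\
    forall x, x != 0 -> T x -> List.Exists (fun Z => Z x) pieces.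

(* Main.v *)
(* Let x be a Darmon point off Q with X_0 <> 0.  Away from finitely many places,
   n_v(Q, x) is v(f(x)) - 2 v(x), so all valuations of f(x) are even there.  Such
   elements form a finite group modulo squares, hence f(x) = b c^2 with b in a
   finite set, and x lifts to the double cover b y^2 = f, which is integral
   because f is not a constant times a square.

   The finiteness needs neither class groups nor units.  Given a with even
   valuations, M = {c : a c^2 is integral} is a lattice on which the form
   Tr(a x y) is integral; evenness says that a M M is almost the unit ideal, so
   M is almost self-dual and its discriminant is bounded.  After multiplying a by
   a square one may take it of absolute value about 1 at all archimedean places;
   then the pigeonhole principle gives a nonzero c in M that is small at all of
   them, and a c^2 is an algebraic integer with bounded conjugates. *)

Require Import Defs.
From HB Require Import structures.
From Stdlib Require List.
From Stdlib Require Import Classical ClassicalEpsilon.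
From mathcomp Require Import all_boot all_order all_algebra all_field.
From mathcomp Require Import ring lra zify.
From mathcomp Require Import mpoly.

Set Implicit Arguments.
Unset Strict Implicit.
Unset Printing Implicit Defensive.
Import Order.TTheory GRing.Theory Num.Theory.
Local Open Scope ring_scope.

(** * Algebraic integers *)

(** One nonzero integer N records all the bad places: those of S, those where a coefficient of f is
    not integral, and those where its leading coefficient is not a unit. At any other place Gauss's
    lemma shows that f alone generates the local ideal of the closure of Q.

    The Darmon condition speaks of abstract valuations, whereas the lattice argument takes place in
    the ring O of algebraic integers. The bridge is that every maximal ideal p of O yields a
    valuation: there is u outside O with u p inside O, and u^-1 then acts as a uniformiser at p. In
    the other direction only the easy inclusion of O in each valuation ring is used.

    The lattice M is given by a quadratic condition; it is a group because (a c d)^2 = (a c^2)(a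
    d^2) and O is integrally closed. Bases of O and of M come from one source: a family with Gram
    determinant of minimal nonzero absolute value generates. The same minimality, tested against a
    multiple of the dual basis, bounds the discriminant. *)

Definition alg_integer (K : fieldType) (x : K) : Prop :=
  integralOver (intr : int -> K) x.

Lemma alg_integer_int (K : fieldType) (z : int) : alg_integer (z%:~R : K).
Proof. exact: (integral_id (intr : {rmorphism int -> K}) z). Qed.

Lemma alg_integerD (K : fieldType) (x y : K) :
  alg_integer x -> alg_integer y -> alg_integer (x + y).
Proof. exact: (@integral_add _ _ (intr : {rmorphism int -> K})). Qed.

Lemma alg_integerB (K : fieldType) (x y : K) :
  alg_integer x -> alg_integer y -> alg_integer (x - y).
Proof. exact: (@integral_sub _ _ (intr : {rmorphism int -> K})). Qed.

Lemma alg_integerM (K : fieldType) (x y : K) :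
  alg_integer x -> alg_integer y -> alg_integer (x * y).
Proof. exact: (@integral_mul _ _ (intr : {rmorphism int -> K})). Qed.

Lemma alg_integerX (K : fieldType) (x : K) k :
  alg_integer x -> alg_integer (x ^+ k).
Proof.
move=> xO; elim: k => [|k IH]; first exact: (alg_integer_int K 1).
by rewrite exprS; apply: alg_integerM.
Qed.

Lemma alg_integer_sum (K : fieldType) I (r : seq I) (P : pred I) (F : I -> K) :
  (forall i, P i -> alg_integer (F i)) -> alg_integer (\sum_(i <- r | P i) F i).
Proof.
move=> FO; apply: big_ind => //; first exact: (alg_integer_int K 0).
exact: alg_integerD.
Qed.

Lemma alg_integer_rmorph (K : fieldType) (s : {rmorphism K -> algC}) x :
  alg_integer x -> s x \in Aint.
Proof.
case=> p mon_p root_p.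
apply: (@root_monic_Aint (map_poly intr p)).
- have -> : map_poly (intr : int -> algC) p = map_poly s (map_poly intr p).
    by rewrite -map_poly_comp; apply: eq_map_poly => z /=; rewrite rmorph_int.
  by rewrite fmorph_root.
- exact: monic_map.
- by apply/polyOverP => i; rewrite coef_map /= intr_int.
Qed.

Lemma alg_integer_sqr (K : fieldType) (x : K) :
  alg_integer (x ^+ 2) -> alg_integer x.
Proof.
move=> xO; apply: (@integral_root_monic _ _ (intr : {rmorphism int -> K}) _
  ('X^2 - (x ^+ 2)%:P)).
- by rewrite monicXnsubC.
- by rewrite /root !hornerE subrr.
- apply/integral_poly => i; rewrite coefB coefXn coefC.
  apply: alg_integerB; first exact: (alg_integer_int K (Posz (i == 2)%N)).
  by case: ifP => _ //; apply: (alg_integer_int K 0).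
Qed.

Section NumberField.
Variable K : fieldExtType rat.
Implicit Types (x y : K).

Lemma numfield_intr_eq0 (z : int) : (z%:~R == 0 :> K) = (z == 0).
Proof.
have -> : z%:~R = (z%:~R : rat)%:A :> K by rewrite scaler_int.
by rewrite scaler_eq0 oner_eq0 orbF intr_eq0.
Qed.

Lemma numfield_intr_inj : injective (intr : int -> K).
Proof.
move=> y z /eqP; rewrite -subr_eq0 -rmorphB /= numfield_intr_eq0 subr_eq0.
by move/eqP.
Qed.

(** If an integer polynomial q of degree n and leading coefficient c kills x, then c x is a root of
    the monic integer polynomial c^(n-1) q(X/c), which is [r] in the proof. *)
Lemma alg_integer_scale x : exists2 h : int, h != 0 & alg_integer (h%:~R * x).
Proof.
have [q [q0 qx]] : exists q : {poly int}, q != 0 /\ root (map_poly intr q) x.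
  have /polyOver1P[p def_p] := minPolyOver 1 x.
  have [q [a a0 def_q]] := rat_poly_scale p.
  exists q; split.
    apply: contraTneq (monic_minPoly 1 x) => q0.
    by rewrite def_p def_q q0 map_poly0 scaler0 map_poly0 qualifE /= lead_coef0
      eq_sym oner_eq0.
  have := root_minPoly 1 x; rewrite def_p def_q.
  rewrite map_polyZ /= rootZ; last first.
    by rewrite scaler_eq0 oner_eq0 orbF invr_eq0 intr_eq0.
  rewrite -map_poly_comp; congr (root _ x).
  by apply: eq_map_poly => z /=; rewrite scaler_int.
set n := (size q).-1; set c := lead_coef q.
have c0 : c != 0 by rewrite lead_coef_eq0.
have n0 : (0 < n)%N.
  rewrite /n; case def_s : (size q) => [|[|s]] //.
    by move/eqP: def_s; rewrite size_poly_eq0 (negbTE q0).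
  move: qx; have /size_poly1P[d d0 ->] : size q == 1%N by rewrite def_s.
  by rewrite map_polyC rootC numfield_intr_eq0 (negbTE d0).
have sq : size q = n.+1 by rewrite /n prednK // size_poly_gt0.
pose r := \poly_(i < n.+1) (if i == n then 1 else q`_i * c ^+ (n.-1 - i)).
have rn : r`_n = 1 by rewrite coef_poly ltnSn eqxx.
have sr : size r = n.+1 by rewrite size_poly_eq ?eqxx ?oner_eq0.
exists c => //; exists r; first by rewrite monicE lead_coefE sr rn.
move: qx; rewrite /root => /eqP qx; apply/eqP.
have sm (p : {poly int}) : size (map_poly (intr : int -> K) p) = size p.
  by apply: size_map_inj_poly => //; apply: numfield_intr_inj.
rewrite horner_coef sm sr.
transitivity ((c%:~R ^+ n.-1 : K) * (map_poly intr q).[x]); last by rewrite qx mulr0.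
rewrite horner_coef sm sq mulr_sumr; apply: eq_bigr => i _.
rewrite !coef_map /= coef_poly ltn_ord exprMn.
case: eqP => [->|/eqP ni].
  rewrite -[in LHS](prednK n0) exprS.
  have -> : q`_n = c by rewrite /c lead_coefE.
  by rewrite (prednK n0) mulr1z mul1r; ring.
have lti : (i <= n.-1)%N by have := ltn_ord i; lia.
rewrite rmorphM rmorphXn /=.
rewrite -[in RHS](subnK lti) exprD; ring.
Qed.

End NumberField.

(** * Embeddings of a number field *)

Section Embeddings.
Variable K : fieldExtType rat.
Implicit Types (x y : K).

Lemma exists_integral_primitive :
  exists2 theta : K, alg_integer theta & <<1; theta>>%VS = fullv.
Proof.
have sepK : separable (1%AS : {subfield K}) {:K}%AS.
  by apply/separableP => y _; apply: pcharf0_separable => p; rewrite pchar_lalg pchar_num.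
have def_K := eq_adjoin_separable_generator sepK (subvf _).
set t := separable_generator _ _ in def_K.
have [h h0 htO] := alg_integer_scale t.
exists (h%:~R * t) => //.
apply/eqP; rewrite eqEsubv subvf /= {1}def_K /=.
apply/FadjoinP; split; first exact: subv_adjoin.
have h0K : (h%:~R : K) != 0 by rewrite numfield_intr_eq0.
rewrite -{1}(mulKf h0K t); apply: rpredM; last exact: memv_adjoin.
by rewrite rpredV; apply: rpred_int.
Qed.

(* The embeddings are the evaluations at the complex roots of the minimal
   polynomial of a primitive element [theta]. *)
Lemma exists_embeddings :
  exists (n : nat) (w : 'I_n -> K) (s : 'I_n -> {rmorphism K -> algC}),
  [/\ forall i, alg_integer (w i),
      forall x, exists q : 'I_n -> rat, x = \sum_i q i *: w i,
      (\matrix_(i, j) s i (w j)) \in unitmx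
    & forall i, exists j, forall x, s j x = (s i x)^*].
Proof.
have [th thO def_K] := exists_integral_primitive.
pose ia := in_alg K : {rmorphism rat -> K}.
have /polyOver1P[P def_P] := minPolyOver 1 th.
have P_th : (map_poly ia P).[th] = 0 by rewrite /= -def_P minPolyxx.
have monP : P \is monic by have := monic_minPoly 1 th; rewrite def_P map_monic.
have sepP : separable_poly P.
  rewrite -(separable_map ia) /= -def_P.
  by apply: pcharf0_separable => p; rewrite pchar_lalg pchar_num.
have dvdP p : (map_poly ia p).[th] = 0 -> P %| p.
  move=> /rootP p_th; rewrite -(dvdp_map ia) /= -def_P minPoly_dvdp //.
  by apply/polyOver1P; exists p.
pose n := (size P).-1.
have sP : size P = n.+1 by rewrite prednK // lt0n size_poly_eq0 monic_neq0.
have genK x : exists p : {poly rat}, (size p <= n)%N && ((map_poly ia p).[th] == x).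
  have x_in : x \in <<1; th>>%VS by rewrite def_K memvf.
  have /Fadjoin_polyP[q /polyOver1P[p ->] ->] := x_in.
  exists (p %% P); rewrite -ltnS -sP ltn_modp monic_neq0 //=.
  rewrite {2}(divp_eq p P) rmorphD rmorphM /= hornerD hornerM -/ia P_th.
  by rewrite mulr0 add0r.
pose c x := xchoose (genK x).
have c_size x : (size (c x) <= n)%N by have /andP[] := xchooseP (genK x).
have cE x : (map_poly ia (c x)).[th] = x by have /andP[_ /eqP] := xchooseP (genK x).
pose CC := ratr : rat -> algC.
have [rs def_rs] := closed_field_poly_normal (map_poly CC P).
move: def_rs; rewrite (monicP _) ?monic_map // scale1r => def_rs.
have rs_uniq : uniq rs by rewrite -separable_prod_XsubC -def_rs separable_map.
have rs_size : size rs = n.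
  by apply: succn_inj; rewrite -sP -(size_prod_XsubC rs id) -def_rs size_map_poly.
have rootP_rs z : root (map_poly CC P) z = (z \in rs).
  by rewrite def_rs root_prod_XsubC.
pose s z x := (map_poly CC (c x)).[z].
have sE z p : z \in rs -> s z (map_poly ia p).[th] = (map_poly CC p).[z].
  rewrite -rootP_rs => /rootP Pz; apply/eqP; rewrite -subr_eq0 /s -hornerN -hornerD.
  rewrite -rmorphN -rmorphD /=.
  have /dvdpP[q ->] : P %| c (map_poly ia p).[th] - p.
    by apply: dvdP; rewrite rmorphB hornerD hornerN /= -/ia cE subrr.
  by rewrite rmorphM /= hornerM Pz mulr0.
have sB z : z \in rs -> zmod_morphism (s z).
  move=> zr x y; rewrite -{1}(cE x) -{1}(cE y) -hornerN -hornerD -rmorphN -rmorphD.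
  by rewrite sE // rmorphB hornerD hornerN.
have sM z : z \in rs -> monoid_morphism (s z).
  move=> zr; split.
    have -> : (1 : K) = (map_poly ia 1).[th] by rewrite rmorph1 hornerC.
    by rewrite sE // rmorph1 hornerC.
  move=> x y; rewrite -{1}(cE x) -{1}(cE y) -hornerM -rmorphM.
  by rewrite sE // rmorphM hornerM.
have zr (i : 'I_n) : rs`_i \in rs by rewrite mem_nth // rs_size.
pose S (i : 'I_n) : {rmorphism K -> algC} :=
  HB.pack (s rs`_i)
   (GRing.isZmodMorphism.Build K algC (s rs`_i) (sB _ (zr i)))
   (GRing.isMonoidMorphism.Build K algC (s rs`_i) (sM _ (zr i))).
exists n, (fun j : 'I_n => th ^+ j), S.
have S_pow i (j : 'I_n) : S i (th ^+ j) = rs`_i ^+ j.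
  have -> : th ^+ j = (map_poly ia 'X^j).[th] by rewrite map_polyXn hornerXn.
  by rewrite /= sE // map_polyXn hornerXn.
split.
- by move=> j; apply: alg_integerX.
- move=> x; exists (fun j => (c x)`_j); rewrite -{1}(cE x) (@horner_coef_wide _ n) //.
    by apply: eq_bigr => j _; rewrite coef_map /= mulr_algl.
  by rewrite size_map_poly.
- have -> : \matrix_(i, j) S i (th ^+ j) =
      (Vandermonde n (\row_(j < n) rs`_j))^T :> 'M[algC]_n.
    by apply/matrixP => i j; rewrite !mxE S_pow.
  rewrite unitmxE det_tr det_Vandermonde unitfE.
  apply/prodf_neq0 => i _; apply/prodf_neq0 => j ltij.
  by rewrite !mxE subr_eq0 nth_uniq ?rs_size // gtn_eqF.
- move=> i.
  have CCc p : map_poly (fun z : algC => z^*) (map_poly CC p) = map_poly CC p.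
    rewrite -map_poly_comp; apply: eq_map_poly => q /=.
    by rewrite conj_Crat // Crat_rat.
  have zj : (rs`_i)^* \in rs.
    have := zr i; rewrite -!rootP_rs => /rootP Pz; apply/rootP.
    by rewrite -CCc horner_map Pz rmorph0.
  have ltj : (index (rs`_i)^* rs < n)%N by rewrite -[ltnRHS]rs_size index_mem.
  exists (Ordinal ltj) => x /=; rewrite nth_index //.
  by rewrite /s -horner_map /= CCc.
Qed.
End Embeddings.

(** * Traces and lattices *)

(** Expansion along row i pairs the rows of B with the cofactors of row i, and B adj(B) = det(B)
    leaves only the coefficient of row i. This drives the descent in [lattice_basis], with a
    coefficient strictly between 0 and 1. *)
Lemma det_replace_row (R : comNzRingType) n (A B : 'M[R]_n) (i : 'I_n) (p : 'I_n -> R) :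
  (forall k j, k != i -> A k j = B k j) ->
  (forall j, A i j = \sum_k p k * B k j) -> \det A = p i * \det B.
Proof.
move=> AB Ai; rewrite (expand_det_row A i).
have cofE j : cofactor A i j = cofactor B i j.
  rewrite /cofactor; congr (_ * \det _); apply/matrixP => k l; rewrite !mxE.
  by rewrite AB // eq_sym neq_lift.
transitivity (\sum_k p k * (B *m \adj B) k i).
  transitivity (\sum_j \sum_k p k * (B k j * cofactor B i j)).
    by apply: eq_bigr => j _; rewrite Ai cofE mulr_suml; apply: eq_bigr => k _; rewrite mulrA.
  rewrite exchange_big /=; apply: eq_bigr => k _.
  by rewrite -mulr_sumr mxE; congr (_ * _); apply: eq_bigr => j _; rewrite [(\adj B) _ _]mxE.
rewrite mul_mx_adj (bigD1 i) //= big1 ?addr0 => [|k /negbTE ki]; rewrite mxE.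
  by rewrite eqxx.
by rewrite ki mulr0.
Qed.

(** A rational basis made of integers, not necessarily an integral basis, with equally many complex
    embeddings. Invertibility of the embedding matrix contains the linear independence of the
    basis. *)
Record number_field_frame (K : fieldExtType rat) := NumberFieldFrame {
  deg : nat;
  bas : 'I_deg -> K;
  emb : 'I_deg -> {rmorphism K -> algC};
  bas_integer : forall i, alg_integer (bas i);
  bas_gen : forall x, exists q : 'I_deg -> rat, x = \sum_i q i *: bas i;
  emb_unitmx : (\matrix_(i, j) emb i (bas j)) \in unitmx;
  emb_conj : forall i, exists j, forall x, emb j x = (emb i x)^*
}.

Section Frame.
Variables (K : fieldExtType rat) (Fr : number_field_frame K).
Local Notation n := (deg Fr).
Local Notation w := (@bas K Fr).
Local Notation s := (@emb K Fr).
Implicit Types (x y a : K) (e : 'I_n -> K).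

Definition emb_mx : 'M[algC]_n := \matrix_(j, i) s i (w j).

Lemma emb_mx_unit : emb_mx \in unitmx.
Proof.
rewrite -unitmx_tr; have -> // : emb_mx^T = \matrix_(i, j) s i (w j).
  by apply/matrixP => i j; rewrite !mxE.
exact: emb_unitmx.
Qed.

Definition vec (v : 'rV[rat]_n) : K := \sum_j v 0 j *: w j.

Lemma vecD u v : vec (u + v) = vec u + vec v.
Proof. by rewrite -big_split; apply: eq_bigr => j _; rewrite !mxE scalerDl. Qed.

Lemma vecZ q v : vec (q *: v) = q *: vec v.
Proof. by rewrite scaler_sumr; apply: eq_bigr => j _; rewrite !mxE scalerA. Qed.

Lemma emb_vec v i : s i (vec v) = (map_mx ratr v *m emb_mx) 0 i.
Proof.
rewrite raddf_sum mxE; apply: eq_bigr => j _; rewrite [LHS](rmorphZ_num (s i)).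
by rewrite !mxE.
Qed.

Lemma vec_inj : injective vec.
Proof.
move=> u v uv; apply: (@map_mx_inj _ _ (ratr : {rmorphism rat -> algC})).
apply: (can_inj (mulmxK emb_mx_unit)); apply/rowP => i.
by rewrite -!emb_vec uv.
Qed.

Lemma exists_vec x : exists v, vec v == x.
Proof.
have [q ->] := bas_gen Fr x; exists (\row_j q j); apply/eqP.
by apply: eq_bigr => j _; rewrite mxE.
Qed.

Definition coord x : 'rV[rat]_n := xchoose (exists_vec x).

Lemma coordK : cancel coord vec.
Proof. by move=> x; apply/eqP; exact: (xchooseP (exists_vec x)). Qed.

Lemma vecK : cancel vec coord.
Proof. by move=> v; apply: vec_inj; rewrite coordK. Qed.

Lemma coordD x y : coord (x + y) = coord x + coord y.
Proof. by apply: vec_inj; rewrite vecD !coordK. Qed.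

Lemma coordZ q x : coord (q *: x) = q *: coord x.
Proof. by apply: vec_inj; rewrite vecZ !coordK. Qed.

Lemma coord0 : coord 0 = 0.
Proof. by rewrite -(scale0r 0) coordZ scale0r. Qed.

Lemma coord_sum I (r : seq I) (q : I -> rat) (f : I -> K) :
  coord (\sum_(i <- r) q i *: f i) = \sum_(i <- r) q i *: coord (f i).
Proof.
elim/big_rec2: _ => [|i u v _ <-]; first exact: coord0.
by rewrite coordD coordZ.
Qed.

Definition tr x : algC := \sum_i s i x.

Definition mulcoord x : 'M[rat]_n := \matrix_(j, k) coord (x * w j) 0 k.

(** The embedding matrix diagonalises multiplication by x, with the conjugates of x as eigenvalues.
    Hence the sum of the conjugates is rational. *)
Lemma tr_mulcoord x : tr x = ratr (\tr (mulcoord x)).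
Proof.
have mW : map_mx ratr (mulcoord x) *m emb_mx =
    emb_mx *m diag_mx (\row_i s i x).
  apply/matrixP => j i; rewrite mul_mx_diag !mxE mulrC -rmorphM.
  rewrite -[x * _]coordK emb_vec mxE; apply: eq_bigr => k _; by rewrite !mxE.
have -> : ratr (\tr (mulcoord x)) = \tr (map_mx ratr (mulcoord x)) :> algC.
  by rewrite /mxtrace rmorph_sum; apply: eq_bigr => i _; rewrite [RHS]mxE.
rewrite -(mulmxK emb_mx_unit (map_mx ratr (mulcoord x))) mW mxtrace_mulC mulmxA.
rewrite mulVmx ?emb_mx_unit // mul1mx mxtrace_diag.
by apply: eq_bigr => i _; rewrite mxE.
Qed.

Definition trq x : rat := \tr (mulcoord x).

Lemma trqE x : ratr (trq x) = \sum_i s i x :> algC.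
Proof. by rewrite -tr_mulcoord. Qed.

Lemma trqD x y : trq (x + y) = trq x + trq y.
Proof.
apply: (fmorph_inj (ratr : {rmorphism rat -> algC})).
rewrite [RHS]rmorphD /= !trqE -big_split.
by apply: eq_bigr => i _; rewrite rmorphD.
Qed.

Lemma trqZ q x : trq (q *: x) = q * trq x.
Proof.
apply: (fmorph_inj (ratr : {rmorphism rat -> algC})).
rewrite [RHS]rmorphM /= !trqE mulr_sumr.
by apply: eq_bigr => i _; rewrite rmorphZ_num.
Qed.

Lemma trq_sum I (r : seq I) (q : I -> rat) (f : I -> K) :
  trq (\sum_(i <- r) q i *: f i) = \sum_(i <- r) q i * trq (f i).
Proof.
elim/big_rec2: _ => [|i u v _ <-]; first by rewrite -(scale0r 0) trqZ mul0r.
by rewrite trqD trqZ.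
Qed.

Lemma trq_int x : alg_integer x -> trq x \is a Num.int.
Proof.
move=> xO; rewrite -Cint_rat; apply: Cint_rat_Aint; first exact: Crat_rat.
by rewrite trqE rpred_sum // => i _; apply: alg_integer_rmorph.
Qed.

Definition gram a e : 'M[rat]_n := \matrix_(i, j) trq (a * (e i * e j)).

Lemma gram_mul a e e' (Q : 'M[rat]_n) :
  (forall i, e' i = \sum_j Q i j *: e j) -> gram a e' = Q *m gram a e *m Q^T.
Proof.
move=> e'E; apply/matrixP => i j; rewrite !mxE.
have -> : a * (e' i * e' j) =
    \sum_l Q j l *: (\sum_k Q i k *: (a * (e k * e l))).
  rewrite [e' j]e'E !mulr_sumr; apply: eq_bigr => l _.
  rewrite -!scalerAr; congr (_ *: _); rewrite e'E mulr_suml mulr_sumr.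
  by apply: eq_bigr => k _; rewrite -scalerAl -scalerAr.
rewrite trq_sum; apply: eq_bigr => l _; rewrite trq_sum !mxE mulrC; congr (_ * _).
by apply: eq_bigr => k _; rewrite mxE.
Qed.

Lemma gram_bas a :
  map_mx ratr (gram a w) = emb_mx *m diag_mx (\row_i s i a) *m emb_mx^T.
Proof.
apply/matrixP => i j; rewrite !mxE trqE; apply: eq_bigr => k _.
by rewrite mul_mx_diag !mxE !rmorphM /=; ring.
Qed.

Lemma det_gram_bas a :
  ratr (\det (gram a w)) = (\det emb_mx) ^+ 2 * \prod_i s i a :> algC.
Proof.
rewrite -det_map_mx gram_bas !det_mulmx det_tr det_diag.
under eq_bigr => i _ do rewrite mxE.
ring.
Qed.

Definition coord_mx e : 'M[rat]_n := \matrix_i coord (e i).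

Lemma coord_mxE e i : e i = \sum_j coord_mx e i j *: w j.
Proof. by rewrite -{1}(coordK (e i)); apply: eq_bigr => j _; rewrite mxE. Qed.

Lemma det_gram a e :
  \det (gram a e) = (\det (coord_mx e)) ^+ 2 * \det (gram a w).
Proof.
rewrite (gram_mul _ (coord_mxE e)) !det_mulmx det_tr; ring.
Qed.

Lemma det_gram_neq0 a e : a != 0 ->
  (\det (gram a e) != 0) = (\det (coord_mx e) != 0).
Proof.
move=> a0; rewrite det_gram mulf_eq0 sqrf_eq0 negb_or.
suff -> : \det (gram a w) != 0 by rewrite andbT.
rewrite -(fmorph_eq0 (ratr : {rmorphism rat -> algC})) [X in X == 0]det_gram_bas.
rewrite mulf_neq0 // ?expf_neq0 //.
  by have := emb_mx_unit; rewrite unitmxE unitfE.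
by apply/prodf_neq0 => i _; rewrite fmorph_eq0.
Qed.

Lemma coords_in_basis e x : \det (coord_mx e) != 0 ->
  exists q : 'rV[rat]_n, x = \sum_i q 0 i *: e i.
Proof.
move=> e0; exists (coord x *m invmx (coord_mx e)).
apply: (can_inj coordK); rewrite coord_sum.
have -> : coord x = coord x *m invmx (coord_mx e) *m coord_mx e.
  by rewrite mulmxKV // unitmxE unitfE.
rewrite {1}mulmx_sum_row; apply: eq_bigr => i _.
by rewrite mulmxKV ?unitmxE ?unitfE // rowK.
Qed.

(** M is not known to be finitely generated. Gram determinants of families in M are integers, so
    some independent family e has the smallest nonzero absolute value. If an element c of M had a
    coordinate with fractional part f > 0 at e_i, replacing e_i by c minus the integral part times
    e_i would multiply the determinant by f^2 < 1. The minimality is part of the conclusion because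
    [sq_lattice_discriminant] uses it again. *)
Lemma lattice_basis a (M : K -> Prop) :
  a != 0 -> (forall c d, M c -> M d -> M (c - d)) ->
  (forall c d, M c -> M d -> alg_integer (a * (c * d))) ->
  (forall x, exists2 h : int, h != 0 & M (h%:~R * x)) ->
  exists e, [/\ forall i, M (e i), \det (coord_mx e) != 0,
    forall c, M c -> exists z : 'I_n -> int, c = \sum_i (z i)%:~R * e i
  & forall e', (forall i, M (e' i)) -> \det (coord_mx e') != 0 ->
    `|\det (gram a e)| <= `|\det (gram a e')| ].
Proof.
move=> a0 MB Mint Mspan.
have detZ e : (forall i, M (e i)) -> exists k : nat, `|\det (gram a e)| = k%:R.
  move=> Me; have /natrP : `|\det (gram a e)| \is a Num.nat.
    apply: natr_norm_int; apply: rpred_sum => p _; apply: rpredM.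
      by rewrite rpredX // rpredN.
    by apply: rpred_prod => i _; rewrite mxE trq_int //; apply: (Mint).
  done.
pose good k := exists e, [/\ forall i, M (e i), \det (coord_mx e) != 0
  & `|\det (gram a e)| = k%:R].
have ex_good : exists k, good k.
  have /fin_all_exists2[h h0 Mh] := fun i => Mspan (w i).
  pose e i := (h i)%:~R * w i.
  have [k kE] := detZ e Mh; exists k, e; split=> //.
  have -> : coord_mx e = diag_mx (\row_i (h i)%:~R).
    apply/matrixP => i j; rewrite /e !mxE mulrzl -scaler_int coordZ mxE.
    have -> : w i = vec (delta_mx 0 i).
      rewrite /vec (bigD1 i) //= big1 => [|l /negbTE li].
        by rewrite mxE !eqxx scale1r addr0.
      by rewrite mxE li scale0r.
    by rewrite vecK mxE eqxx /= eq_sym; case: eqP => _; rewrite ?mulr1 ?mulr0.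
  by rewrite det_diag; apply/prodf_neq0 => i _; rewrite mxE intr_eq0.
have [k [[e [Me e0 eE]] min_k]] :
    exists k, good k /\ forall k', good k' -> (k <= k')%N.
  apply: NNPP => nomin; case: ex_good => k.
  elim/ltn_ind: k => k IH gk; apply: nomin; exists k; split=> // k' gk'.
  by rewrite leqNgt; apply/negP => /IH /(_ gk').
have min_e e' : (forall i, M (e' i)) -> \det (coord_mx e') != 0 ->
    `|\det (gram a e)| <= `|\det (gram a e')|.
  move=> Me' e'0; have [k' k'E] := detZ e' Me'.
  by rewrite eE k'E ler_nat; apply: min_k; exists e'.
exists e; split=> // c Mc.
have [q qE] := coords_in_basis c e0.
have MN c' : M c' -> M (- c').
  by move=> Mc'; rewrite -sub0r; apply: (MB) => //; rewrite -(subrr c'); apply: (MB).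
have Mz (z : int) c' : M c' -> M (z%:~R * c').
  move=> Mc'; have M0 : M 0 by rewrite -(subrr c'); apply: (MB).
  have Mn (m : nat) : M (m%:R * c').
    elim: m => [|m IH]; first by rewrite mul0r.
    by rewrite -addn1 natrD mulrDl mul1r -[c' in _ + c']opprK; apply: (MB) => //; apply: (MN).
  by case: z => m; rewrite ?NegzE ?rmorphN ?mulNr /=; [|apply: (MN)]; apply: Mn.
have qint i : q 0 i \is a Num.int.
  set f := q 0 i - (Num.floor (q 0 i))%:~R.
  have /andP[f_ge0 f_lt1] : 0 <= f < 1.
    have /andP[h1 h2] := floor_itv (q 0 i); rewrite /f.
    by move: h2; rewrite rmorphD /= => h2; apply/andP; split; lra.
  have [f0|f0] := eqVneq f 0.
    by move/eqP: f0; rewrite subr_eq0 => /eqP ->; apply: intr_int.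
  pose e' k := if k == i then c - (Num.floor (q 0 i))%:~R * e i else e k.
  have Me' l : M (e' l) by rewrite /e'; case: eqP => // _; apply: (MB); [|apply: (Mz)].
  have detE : \det (coord_mx e') = f * \det (coord_mx e).
    pose p k := q 0 k - (if k == i then (Num.floor (q 0 i))%:~R else 0).
    rewrite (@det_replace_row _ _ _ (coord_mx e) i p) => [|l j /negbTE li|j].
    - by rewrite /p eqxx.
    - by rewrite !mxE /e' li.
    - rewrite mxE /e' eqxx.
      have -> : c - (Num.floor (q 0 i))%:~R * e i = \sum_k p k *: e k.
        rewrite qE /p; under [RHS]eq_bigr => l _ do rewrite scalerBl.
        rewrite sumrB; congr (_ - _); rewrite (bigD1 i) //= big1 => [|l /negbTE ->].
          by rewrite eqxx addr0 scaler_int mulrzl.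
        by rewrite scale0r.
      rewrite coord_sum summxE; apply: eq_bigr => l _; by rewrite !mxE.
  have e'0 : \det (coord_mx e') != 0 by rewrite detE mulf_neq0.
  have detG : \det (gram a e') = f ^+ 2 * \det (gram a e).
    by rewrite (det_gram a e') (det_gram a e) detE; ring.
  have := min_e e' Me' e'0; rewrite detG normrM ler_pMl; last first.
    by rewrite normr_gt0 det_gram_neq0.
  by rewrite ger0_norm ?exprn_ge0 // => f2; nra.
have /fin_all_exists[z zE] : forall i, exists z : int, q 0 i = z%:~R.
  by move=> i; apply/intrP; apply: qint.
exists z; rewrite {1}qE; apply: eq_bigr => i _.
by rewrite zE scaler_int mulrzl.
Qed.

End Frame.

Lemma exists_choice_fun (A B : Type) (R : A -> B -> Prop) :
  (forall x, exists y, R x y) -> exists f, forall x, R x (f x).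
Proof.
move=> exR; exists (fun x => proj1_sig (constructive_indefinite_description _ (exR x))).
by move=> x; apply: proj2_sig (constructive_indefinite_description _ (exR x)).
Qed.

(** * Integrality criteria, residues, the trace dual, and integers with bounded conjugates *)

Section FrameArithmetic.
Variables (K : fieldExtType rat) (Fr : number_field_frame K).
Local Notation n := (deg Fr).
Local Notation w := (@bas K Fr).
Local Notation s := (@emb K Fr).
Implicit Types (x y a u o z : K) (e : 'I_n -> K).

(** Multiplication by u acts on a basis of M through an integer matrix, and the basis itself is an
    eigenvector with eigenvalue u. So u is a root of the characteristic polynomial of that matrix.
    The eigenvector is nonzero since 1 is a combination of its entries. *)
Lemma stable_lattice_integer (M : K -> Prop) u :
  (forall c d, M c -> M d -> M (c - d)) -> (forall c, M c -> alg_integer c) ->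
  (forall x, exists2 h : int, h != 0 & M (h%:~R * x)) ->
  (forall c, M c -> M (u * c)) -> alg_integer u.
Proof.
move=> MB MO Mspan Mu.
have [|e [Me e0 gen_e _]] := @lattice_basis K Fr 1 M (oner_neq0 _) MB _ Mspan.
  by move=> c d Mc Md; rewrite mul1r; apply: alg_integerM; apply: (MO).
have /fin_all_exists[B BE] := fun i => gen_e _ (Mu _ (Me i)).
pose A : 'M[int]_n := \matrix_(i, j) B j i.
exists (char_poly A); first exact: char_poly_monic.
rewrite (map_char_poly (intr : {rmorphism int -> K})) -eigenvalue_root_char.
apply/eigenvalueP; exists (\row_i e i).
  apply/rowP => j; rewrite !mxE BE; apply: eq_bigr => i _.
  by rewrite !mxE mulrC.
apply/eqP => /rowP v0; have := oner_neq0 K.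
have [q ->] := coords_in_basis 1 e0; rewrite big1 ?eqxx // => i _.
by have := v0 i; rewrite !mxE => ->; rewrite scaler0.
Qed.

(** O is completely integrally closed: the x for which all u^k x are integral form a lattice stable
    under u, and it spans K because it contains o. *)
Lemma alg_integer_powers u o : o != 0 ->
  (forall k, alg_integer (u ^+ k * o)) -> alg_integer u.
Proof.
move=> o0 uo; apply: (@stable_lattice_integer (fun x => forall k, alg_integer (u ^+ k * x))).
- by move=> c d Mc Md k; rewrite mulrBr; apply: alg_integerB.
- by move=> c /(_ 0%N); rewrite mul1r.
- move=> x; have [h h0 hO] := alg_integer_scale (x / o); exists h => // k.
  have -> : u ^+ k * (h%:~R * x) = (h%:~R * (x / o)) * (u ^+ k * o) by field.
  exact: alg_integerM.
- by move=> c Mc k; rewrite mulrA -exprSr.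
Qed.

(** The finiteness of O/N, expressed by a map to a finite type instead of a quotient ring. It takes
    the coordinates in an integral basis modulo N; its values outside O are arbitrary. *)
Lemma finite_residues (N : int) : N != 0 ->
  exists (F : finType) (f : K -> F), forall x y : K,
    alg_integer x -> alg_integer y -> f x = f y -> alg_integer ((x - y) / N%:~R).
Proof.
move=> N0.
have [|e [Oe e0 gen_e _]] := @lattice_basis K Fr 1 (@alg_integer (K : fieldType)) (oner_neq0 _)
  (@alg_integerB K) _ (@alg_integer_scale K).
  by move=> c d Oc Od; rewrite mul1r; apply: alg_integerM.
have lt_mod (z : int) : (`|(z %% N)%Z|%N < `|N|%N)%N.
  by have := modz_ge0 z N0; have := ltz_mod z N0; lia.
pose F := {ffun 'I_n -> 'I_`|N|%N}.
have ex_f x : exists v : F, alg_integer x -> exists z : 'I_n -> int,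
    x = \sum_i (z i)%:~R * e i /\ forall i, (v i : nat) = `|(z i %% N)%Z|%N.
  have [Ox|nOx] := classic (alg_integer x); last first.
    by exists [ffun i => Ordinal (lt_mod 0)].
  have [z xE] := gen_e x Ox.
  exists [ffun i => Ordinal (lt_mod (z i))] => _; exists z; split=> // i.
  by rewrite ffunE.
have [f fE] := exists_choice_fun ex_f.
exists F, f => x y Ox Oy fxy.
have [z [xE zE]] := fE x Ox; have [z' [yE z'E]] := fE y Oy.
rewrite xE yE -sumrB mulr_suml; apply: alg_integer_sum => i _.
have : (N %| z i - z' i)%Z.
  rewrite -eqz_mod_dvd; apply/eqP.
  have := zE i; rewrite fxy z'E.
  have := modz_ge0 (z i) N0; have := modz_ge0 (z' i) N0; lia.
case/dvdzP=> k kE; rewrite -mulrBl -rmorphB kE rmorphM /=.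
have NK : (N%:~R : K) != 0 by rewrite numfield_intr_eq0.
have -> : k%:~R * N%:~R * e i / N%:~R = k%:~R * e i by field.
apply: alg_integerM => //; exact: alg_integer_int.
Qed.

Lemma coord_bas i : coord Fr (w i) = delta_mx 0 i.
Proof.
apply: (@vec_inj K Fr); rewrite coordK /vec (bigD1 i) //= big1 => [|l /negbTE li].
  by rewrite mxE !eqxx scale1r addr0.
by rewrite mxE li scale0r.
Qed.

Lemma det_gram_bas_neq0 : \det (gram 1 w) != 0.
Proof.
rewrite det_gram_neq0 ?oner_neq0 //.
suff -> : coord_mx w = 1%:M by rewrite det1 oner_neq0.
by apply/row_matrixP => i; rewrite rowK row1 coord_bas.
Qed.

Lemma trq_bas z : \row_i trq Fr (z * w i) = coord Fr z *m gram 1 w.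
Proof.
apply/rowP => i; rewrite !mxE -{1}(coordK Fr z) /vec mulr_suml.
under eq_bigr => j _ do rewrite -scalerAl.
by rewrite trq_sum; apply: eq_bigr => j _; rewrite !mxE mul1r.
Qed.

Lemma gram_bas_int i j : gram 1 w i j \is a Num.int.
Proof.
by rewrite mxE mul1r; apply: trq_int; apply: alg_integerM; apply: bas_integer.
Qed.

(** The inverse different has bounded denominators. The traces of the z w_i are the coordinates of z
    times the integral Gram matrix of the frame basis; with d its determinant, Cramer's rule
    replaces the inverse matrix by the integral adjugate. *)
Lemma trace_dual : exists2 d : int, d != 0 &
  forall z, (forall o, alg_integer o -> trq Fr (z * o) \is a Num.int) ->
    alg_integer (d%:~R * z).
Proof.
have G0 := det_gram_bas_neq0.
have int_det m (A : 'M[rat]_m) : (forall i j, A i j \is a Num.int) -> \det A \is a Num.int.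
  move=> Aint; apply: rpred_sum => p _; apply: rpredM.
    by rewrite rpredX // rpredN.
  by apply: rpred_prod => i _.
have /intrP[d dE] := int_det _ _ gram_bas_int.
exists d; first by move: G0; rewrite dE intr_eq0.
move=> z zint.
have dz : d%:~R *: coord Fr z = (\row_i trq Fr (z * w i)) *m \adj (gram 1 w).
  by rewrite trq_bas -mulmxA mul_mx_adj -dE mul_mx_scalar.
rewrite mulrzl -scaler_int -(coordK Fr z) -vecZ dz; apply: alg_integer_sum => i _.
suff /intrP[k ->] : ((\row_i trq Fr (z * w i)) *m \adj (gram 1 w)) 0 i \is a Num.int.
  rewrite scaler_int -mulrzl; apply: alg_integerM; last exact: bas_integer.
  exact: alg_integer_int.
rewrite mxE; apply: rpred_sum => j _; rewrite !mxE; apply: rpredM.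
  by apply: zint; apply: bas_integer.
apply: rpredM; first by rewrite rpredX // rpredN.
by apply: int_det => k l; rewrite 2!mxE; apply: gram_bas_int.
Qed.

(** An element is determined by its traces against the frame basis. For x as here these are
    integers, all bounded by [B], so a list indexed by the tuples of integers in [-B, B]
    suffices. *)
Lemma finite_bounded_integers (C : nat) : exists l : seq K,
  forall x, alg_integer x -> (forall i, `|s i x| <= C%:R) -> x \in l.
Proof.
have B_ge0 : 0 <= \sum_i \sum_k C%:R * `|s k (w i)|.
  by apply: sumr_ge0 => i _; apply: sumr_ge0 => k _; rewrite mulr_ge0.
pose B := Num.bound (\sum_i \sum_k C%:R * `|s k (w i)|).
have B_gt := archi_boundP B_ge0; rewrite -/B in B_gt.
pose g (t : {ffun 'I_n -> 'I_(2 * B).+1}) : K :=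
  @vec K Fr ((\row_i ((t i : nat)%:R - B%:R)) *m invmx (gram 1 w)).
exists [seq g t | t : {ffun 'I_n -> 'I_(2 * B).+1}] => x xO xC.
have t_ex i : exists t : 'I_(2 * B).+1, trq Fr (x * w i) = (t : nat)%:R - B%:R.
  have /intrP[z zE] : trq Fr (x * w i) \is a Num.int.
    by apply: trq_int; apply: alg_integerM => //; apply: bas_integer.
  have zB : `|z%:~R| <= B%:R :> algC.
    have -> : z%:~R = ratr (trq Fr (x * w i)) :> algC by rewrite zE ratr_int.
    rewrite trqE; apply: le_trans (ltW B_gt).
    apply: le_trans (ler_norm_sum _ _ _) _.
    rewrite [leRHS](bigD1 i) //= -[leLHS]addr0 lerD //.
      apply: ler_sum => k _; rewrite rmorphM normrM.
      by apply: ler_wpM2r.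
    by apply: sumr_ge0 => j _; apply: sumr_ge0 => k _; rewrite mulr_ge0.
  move: zB; rewrite -intr_norm -[B%:R]/(B%:Z%:~R) ler_int => zB.
  have ltz : (absz (z + B%:Z)%R < (2 * B).+1)%N by lia.
  exists (Ordinal ltz) => /=; rewrite zE.
  have -> : (absz (z + B%:Z)%R)%:R = (z + B%:Z)%:~R :> rat.
    by rewrite -[LHS]/((Posz (absz (z + B%:Z)%R))%:~R); congr (_%:~R); lia.
  by rewrite rmorphD /= addrK.
have /fin_all_exists[t tE] := t_ex.
have -> : x = g (finfun t).
  apply: (can_inj (coordK Fr)); rewrite vecK.
  have -> : \row_i ((finfun t i : nat)%:R - B%:R) = coord Fr x *m gram 1 w :> 'rV[rat]_n.
    by rewrite -trq_bas; apply/rowP => i; rewrite !mxE ffunE tE.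
  by rewrite mulmxK // unitmxE unitfE det_gram_bas_neq0.
by apply: image_f.
Qed.
End FrameArithmetic.

(** * Valuations attached to maximal ideals *)

Lemma infinite_pigeonhole (F : finType) (g : nat -> F) :
  exists i j, (i < j)%N /\ g i = g j.
Proof.
have /injectivePn[i [j ne_ij gij]] : ~~ injectiveb (fun i : 'I_#|F|.+1 => g i).
  apply/negP => /injectiveP /leq_card; by rewrite card_ord ltnn.
case: (ltngtP i j) => [ltij|ltji|/val_inj eq_ij]; last by rewrite eq_ij eqxx in ne_ij.
  by exists i, j.
by exists j, i.
Qed.

(** * Ideals of the ring of integers *)

Section Ideals.
Variables (K : fieldExtType rat) (Fr : number_field_frame K).
Implicit Types (x y o u c : K) (I J p : K -> Prop).
Local Notation O := (@alg_integer (K : fieldType)).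

Definition int_ideal I : Prop :=
  [/\ forall x, I x -> O x, I 0, forall x y, I x -> I y -> I (x - y)
    & forall o x, O o -> I x -> I (o * x)].

(** An ideal containing N is recovered from its image in the finite type of residues, so a strictly
    increasing chain of such ideals has bounded length. The property P is left free because both
    proper ideals and annihilators will be maximised. *)
Lemma exists_maximal_ideal (P : (K -> Prop) -> Prop) (N : int) : N != 0 ->
  (forall J, P J -> int_ideal J /\ J N%:~R) -> (exists J, P J) ->
  exists J, P J /\
    forall J', P J' -> (forall x, J x -> J' x) -> forall x, J' x -> J x.
Proof.
move=> N0 PJ exJ; have [F [f fE]] := finite_residues Fr N0.
pose im J : {set F} :=
  [set v | if excluded_middle_informative (exists2 x, J x & f x = v) then true else false].
have imP J v : v \in im J <-> exists2 x, J x & f x = v.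
  by rewrite inE; case: excluded_middle_informative.
have im_closed J x : P J -> O x -> f x \in im J -> J x.
  move=> /PJ[[JO J0 JB JM] JN] xO /imP[y Jy fxy].
  have yx : O ((y - x) / N%:~R) by apply: fE; first exact: JO.
  have NK : (N%:~R : K) != 0 by rewrite numfield_intr_eq0.
  have -> : x = y - (y - x) / N%:~R * N%:~R by field.
  by apply: JB => //; apply: JM.
apply: NNPP => nomax; case: exJ => J.
have [k] := ubnP (#|F| - #|im J|)%N; elim: k J => // k IH J ltk PJ1.
apply: nomax; exists J; split=> // J' PJ' sJ x J'x; apply: NNPP => nJx.
have /PJ[[J'O _ _ _] _] := PJ'.
apply: (IH J') => //; rewrite ltnS in ltk.
have ltJ : (#|im J| < #|im J'|)%N.
  apply: proper_card; apply/properP; split.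
    by apply/subsetP => v /imP[y Jy fy]; apply/imP; exists y => //; apply: sJ.
  exists (f x); first by apply/imP; exists x.
  by apply/negP => fx; apply: nJx; apply: im_closed => //; apply: J'O.
apply: leq_trans ltk; have := max_card (im J'); lia.
Qed.

Definition maximal_int_ideal p : Prop :=
  [/\ int_ideal p, ~ p 1
    & forall q, int_ideal q -> (forall x, p x -> q x) -> ~ q 1 -> forall x, q x -> p x].

Lemma exists_maximal_over I (N : int) : N != 0 -> int_ideal I -> I N%:~R -> ~ I 1 ->
  exists2 p, maximal_int_ideal p & forall x, I x -> p x.
Proof.
move=> N0 idI IN nI1.
pose P J := [/\ int_ideal J, ~ J 1 & forall x, I x -> J x].
have [||p [[idp np1 Ip] max_p]] := @exists_maximal_ideal P N N0.
- by move=> J [idJ _ IJ]; split=> //; apply: IJ.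
- by exists I.
- exists p => //; split=> // q idq pq nq1; apply: max_p => //; split=> //.
  by move=> x /Ip; apply: pq.
Qed.

Lemma maximal_prime p x y : maximal_int_ideal p -> O x -> O y ->
  p (x * y) -> ~ p x -> p y.
Proof.
move=> [[pO p0 pB pM] np1 max_p] xO yO pxy npx.
pose q z := exists2 o, O o & p (z - o * x).
have O0 : O 0 by apply: (alg_integer_int K 0).
have O1 : O 1 by apply: (alg_integer_int K 1).
have [o oO p1] : q 1.
  apply: NNPP => nq1; apply: npx; apply: (max_p q) => //.
  - split.
    + move=> z [o oO pz]; rewrite -(subrK (o * x) z).
      by apply: alg_integerD; [apply: pO | apply: alg_integerM].
    + by exists 0; rewrite // mul0r subr0.
    + move=> z z' [o oO pz] [o' oO' pz']; exists (o - o'); first exact: alg_integerB.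
      have -> : z - z' - (o - o') * x = (z - o * x) - (z' - o' * x) by ring.
      exact: pB.
    + move=> o z oO [o' oO' pz]; exists (o * o'); first exact: alg_integerM.
      by rewrite -mulrA -mulrBr; apply: pM.
  - by move=> z pz; exists 0; rewrite // mul0r subr0.
  - by exists 1; rewrite // mul1r subrr.
have -> : y = y * (1 - o * x) - (- o * (x * y)) by ring.
apply: pB; apply: pM => //.
by rewrite -sub0r; apply: alg_integerB.
Qed.

(* The finite ring O/N has an element with annihilator p/N: any element whose
   annihilator is maximal among those contained in p. *)
Lemma maximal_escape p (N : int) : N != 0 -> maximal_int_ideal p -> p N%:~R ->
  exists2 u, ~ O u & forall x, p x -> O (u * x).
Proof.
move=> N0 maxp pN; have [[pO p0 pB pM] np1 _] := maxp.
have NK : (N%:~R : K) != 0 by rewrite numfield_intr_eq0.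
have O0 : O 0 by apply: (alg_integer_int K 0).
have O1 : O 1 by apply: (alg_integer_int K 1).
pose ann c t := O t /\ O (t * c / N%:~R).
have ann_ideal c : O c -> int_ideal (ann c) /\ ann c N%:~R.
  move=> cO; split; last first.
    split; first exact: alg_integer_int.
    by have -> : N%:~R * c / N%:~R = c by field.
  split.
  - by move=> x [].
  - by split; rewrite // !mul0r.
  - move=> x y [xO xc] [yO yc]; split; first exact: alg_integerB.
    by rewrite !mulrBl; apply: alg_integerB.
  - move=> o x oO [xO xc]; split; first exact: alg_integerM.
    by rewrite -!mulrA mulrA -[_ * (c / _)]mulrA; apply: alg_integerM; rewrite // mulrA.
pose P J := exists c, [/\ O c, forall t, J t <-> ann c t & forall t, ann c t -> p t].
have [||J [[c [cO Jc cp]] maxJ]] := @exists_maximal_ideal P N N0.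
- move=> J [c [cO Jc _]]; have [[aO a0 aB aM] aN] := ann_ideal c cO.
  split; last exact/Jc.
  split.
  + by move=> x /Jc/aO.
  + exact/Jc.
  + by move=> x y /Jc ? /Jc ?; apply/Jc; apply: aB.
  + by move=> o x ? /Jc ?; apply/Jc; apply: aM.
- exists (ann 1), 1; split=> // t [tO]; rewrite mulr1 => tN.
  by rewrite -(divfK NK t); apply: pM.
have maxc c' : O c' -> (forall t, ann c' t -> p t) ->
    (forall t, ann c t -> ann c' t) -> forall t, ann c' t -> ann c t.
  move=> cO' c'p cc' t c't; apply/Jc; apply: (maxJ (ann c')) => //.
    by exists c'.
  by move=> x /Jc; apply: cc'.
have annX x : O x -> forall c' t, ann c' t -> ann (c' * x) t.
  move=> xO c' t [tO tc]; split=> //.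
  have -> : t * (c' * x) / N%:~R = t * c' / N%:~R * x by field.
  exact: alg_integerM.
(* Here [ann c] is the annihilator of c in O/N. It omits 1, so c/N is not integral; once it is known
   to contain all of p, multiplication by c/N sends p into O. *)
exists (c / N%:~R) => [uO|x px].
  by apply: np1; apply: cp; split; rewrite // mul1r.
suff [_ xc] : ann c x by rewrite mulrC mulrA.
have xO := pO x px.
(* If Ann(c x) lies in p, maximality gives Ann(c x) = Ann(c), and then Ann(c x^k) lies in Ann(c) for
   all k. Two powers x^i and x^j agree modulo N, so 1 - x^(j-i) kills c x^i and belongs to p; as x
   is in p, so is 1. *)
have [cxp|ncxp] := classic (forall t, ann (c * x) t -> p t).
  have sub1 := maxc _ (alg_integerM cO xO) cxp (annX x xO c).
  have subX k : forall t, ann (c * x ^+ k) t -> ann c t.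
    elim: k => [|k IH] t; first by rewrite expr0 mulr1.
    case=> tO tc; apply: IH; split=> //.
    have [|_] := sub1 (t * x ^+ k).
      split; first by apply: alg_integerM => //; apply: alg_integerX.
      by have -> : t * x ^+ k * (c * x) = t * (c * x ^+ k.+1) by rewrite exprS; ring.
    by have -> : t * x ^+ k * c = t * (c * x ^+ k) by ring.
  have [F [f fE]] := finite_residues Fr N0.
  have [i [j [ltij fij]]] := infinite_pigeonhole (fun k => f (x ^+ k)).
  have xij : O ((x ^+ i - x ^+ j) / N%:~R) by apply: fE => //; apply: alg_integerX.
  have p1x : p (1 - x ^+ (j - i)).
    apply: cp; apply: (subX i); split.
      by apply: alg_integerB => //; apply: alg_integerX.
    have -> : (1 - x ^+ (j - i)) * (c * x ^+ i) / N%:~R = c * ((x ^+ i - x ^+ j) / N%:~R).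
      by rewrite -{2}(subnK (ltnW ltij)) exprD; field.
    exact: alg_integerM.
  case: np1; rewrite -(subrK (x ^+ (j - i)) 1) -[X in _ + X]opprK; apply: pB => //.
  have ji : (0 < j - i)%N by rewrite subn_gt0.
rewrite -(prednK ji) exprSr -mulNr; apply: pM => //.
  by rewrite -sub0r; apply: alg_integerB => //; apply: alg_integerX.
(* Otherwise some t outside p kills c x. Since p is prime, Ann(c t) still lies in p, so by
   maximality it equals Ann(c); and x kills c t. *)
have [t nt] := not_all_ex_not _ _ ncxp.
have [[tO tcx] npt] := imply_to_and _ _ nt.
apply: (maxc (c * t)).
- exact: alg_integerM.
- move=> t' [tO' tc']; have ptt : p (t * t').
    apply: cp; split; first exact: alg_integerM.
    by have -> : t * t' * c = t' * (c * t) by ring.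
  exact: maximal_prime ptt npt.
- exact: annX.
- split=> //; by have -> : x * (c * t) = t * (c * x) by ring.
Qed.

(** * The discrete valuation of a maximal ideal *)

Section Valuation.
Variables (p : K -> Prop) (N : int).
Hypotheses (N0 : N != 0) (maxp : maximal_int_ideal p) (pN : p N%:~R).

Let pO x : p x -> O x. Proof. by case: maxp => -[+ _ _ _] _ _; apply. Qed.
Let p0 : p 0. Proof. by case: maxp => -[]. Qed.
Let pB x y : p x -> p y -> p (x - y).
Proof. by case: maxp => -[_ _ + _] _ _; apply. Qed.
Let pM o x : O o -> p x -> p (o * x).
Proof. by case: maxp => -[_ _ _ +] _ _; apply. Qed.
Let np1 : ~ p 1. Proof. by case: maxp. Qed.
Let O1 : O 1. Proof. exact: (alg_integer_int K 1). Qed.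

Let npM x y : O x -> O y -> ~ p x -> ~ p y -> ~ p (x * y).
Proof. by move=> xO yO npx npy pxy; apply: npy; apply: maximal_prime pxy npx. Qed.

Let npX x k : O x -> ~ p x -> ~ p (x ^+ k).
Proof.
move=> xO npx; elim: k => [|k IH]; first by rewrite expr0.
by rewrite exprS; apply: npM => //; apply: alg_integerX.
Qed.

(* [order_at u x k] says that [x] generates the [k]-th power of the maximal
   ideal of the localisation of O at [p], the inverse of which is generated
   by [u]. *)
Definition order_at u x (k : int) : Prop :=
  exists t y, [/\ O t, ~ p t, O y, ~ p y & x * t * u ^ k = y].

Section Escaping.
Variables (u pi : K).
Hypotheses (nuO : ~ O u) (up : forall x, p x -> O (u * x)).
Hypotheses (ppi : p pi) (npupi : ~ p (u * pi)).

Let u0 : u != 0.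
Proof. by apply/eqP => u0; apply: nuO; rewrite u0; apply: (alg_integer_int K 0). Qed.

Let upiO : O (u * pi).
Proof. exact: up. Qed.

(** In this section [pi] acts as a uniformiser at p and [u] as its inverse, up to the local unit u
    pi. If l = k + j + 1, multiplying the integral element by t pi^(j+1) gives an element of p, but
    it equals y T (u pi)^(j+1), a product of elements outside p. *)
Lemma order_at_le x k l T : order_at u x k -> O T -> ~ p T -> O (x * T * u ^ l) -> l <= k.
Proof.
move=> [t [y [tO npt yO npy xt]]] TO npT xTO; rewrite leNgt; apply/negP => ltkl.
have [j lE] : exists j : nat, l = k + j.+1%:Z.
  by exists (absz (l - k - 1)%R); lia.
have uE : u ^ l = u ^ k * u ^+ j.+1 by rewrite lE expfzDr.
have : p (x * T * u ^ l * t * pi ^+ j * pi).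
  by apply: pM => //; do !apply: alg_integerM => //; apply: alg_integerX; apply: pO.
have -> : x * T * u ^ l * t * pi ^+ j * pi = y * T * (u * pi) ^+ j.+1.
  by rewrite uE -xt exprMn [pi ^+ j.+1]exprSr; ring.
apply: npM; [exact: alg_integerM | exact: alg_integerX | exact: npM | exact: npX].
Qed.

Lemma order_at_ge x k l : order_at u x k -> l <= k ->
  exists T, [/\ O T, ~ p T & O (x * T * u ^ l)].
Proof.
move=> [t [y [tO npt yO npy xt]]] lelk.
have [j kE] : exists j : nat, k = l + j%:Z.
  by exists (absz (k - l)%R); lia.
have uE : u ^ k = u ^ l * u ^+ j by rewrite kE expfzDr.
exists (t * (u * pi) ^+ j); split.
- by apply: alg_integerM => //; apply: alg_integerX.
- by apply: npM; rewrite //; [apply: alg_integerX | apply: npX].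
- have -> : x * (t * (u * pi) ^+ j) * u ^ l = y * pi ^+ j.
    by rewrite -xt uE exprMn; ring.
  by apply: alg_integerM => //; apply: alg_integerX; apply: pO.
Qed.

Lemma order_at_unique x k l : order_at u x k -> order_at u x l -> k = l.
Proof.
move=> xk xl; have [t [y [tO npt yO npy xt]]] := xk.
have [t' [y' [tO' npt' yO' npy' xt']]] := xl.
apply/eqP; rewrite eq_le (order_at_le xl tO npt) ?xt //.
by rewrite (order_at_le xk tO' npt') ?xt'.
Qed.

Lemma order_atM x y k l : order_at u x k -> order_at u y l -> order_at u (x * y) (k + l).
Proof.
move=> [t [z [tO npt zO npz xt]]] [t' [z' [tO' npt' zO' npz' yt']]].
exists (t * t'), (z * z'); split; try exact: alg_integerM; try exact: npM.
by rewrite -xt -yt' expfzDr //; ring.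
Qed.

Lemma order_atV x k : x != 0 -> order_at u x k -> order_at u x^-1 (- k).
Proof.
move=> x0 [t [y [tO npt yO npy xt]]]; exists y, t; split=> //.
have uk0 : u ^ k != 0 by rewrite expfz_neq0.
by rewrite -xt -invr_expz; field; rewrite uk0 x0.
Qed.

(** As long as u^k o stays in p, the next product u^(k+1) o is integral. It cannot stay in p for
    ever, for then u would be integral by [alg_integer_powers]. *)
Lemma order_at_integer o : O o -> o != 0 -> exists k, order_at u o k.
Proof.
move=> oO o0; have [k npk] : exists k, ~ p (u ^+ k * o).
  apply: NNPP => nok; apply: nuO; apply: (alg_integer_powers Fr o0) => k.
  by apply: pO; apply: NNPP => npk; apply: nok; exists k.
suff [m [mO npm]] : exists m, O (u ^+ m * o) /\ ~ p (u ^+ m * o).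
  by exists m%:Z, 1, (u ^+ m * o); split=> //; rewrite mulr1 mulrC.
elim: k npk => [|k IH] npk; first by exists 0%N; split; rewrite // mul1r.
have [pk|] := classic (p (u ^+ k * o)); last exact: IH.
by exists k.+1; split=> //; rewrite exprS -mulrA; apply: up.
Qed.

Lemma order_at_exists x : x != 0 -> exists k, order_at u x k.
Proof.
move=> x0; have [h h0 hO] := alg_integer_scale x.
have hK : (h%:~R : K) != 0 by rewrite numfield_intr_eq0.
have [k xk] := order_at_integer hO (mulf_neq0 hK x0).
have [l hl] := order_at_integer (alg_integer_int K h) hK.
exists (k - l); have -> : x = h%:~R * x * h%:~R^-1 by field.
by apply: order_atM => //; apply: order_atV.
Qed.

Lemma order_valuation : exists v : dvaluation K,
  forall x, x != 0 -> order_at u x (dval v x).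
Proof.
have [f fE] : exists f : K -> int, forall x, x != 0 -> order_at u x (f x).
  apply: (@exists_choice_fun K int (fun x k => x != 0 -> order_at u x k)) => x.
  by have [->|/order_at_exists[k]] := eqVneq x 0; [exists 0 | exists k].
have fM x y : x != 0 -> y != 0 -> f (x * y) = f x + f y.
  move=> x0 y0; apply: (@order_at_unique (x * y)); first by apply: fE; apply: mulf_neq0.
  by apply: order_atM; apply: fE.
have fD x y : x != 0 -> y != 0 -> x + y != 0 -> Num.min (f x) (f y) <= f (x + y).
  move=> x0 y0 xy0; set k := Num.min _ _.
  have [T [TO npT xT]] : exists T, [/\ O T, ~ p T & O (x * T * u ^ k)].
    by apply: (order_at_ge (fE x x0)); rewrite ge_min lexx.
  have [T' [TO' npT' yT']] : exists T, [/\ O T, ~ p T & O (y * T * u ^ k)].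
    by apply: (order_at_ge (fE y y0)); rewrite ge_min lexx orbT.
  apply: (order_at_le (fE _ xy0) (alg_integerM TO TO')); first exact: npM.
  have -> : (x + y) * (T * T') * u ^ k = x * T * u ^ k * T' + y * T' * u ^ k * T by ring.
  by apply: alg_integerD; apply: alg_integerM.
have f1 : exists2 x, x != 0 & f x = 1.
  exists u^-1; first by rewrite invr_eq0.
  have uV0 : u^-1 != 0 by rewrite invr_eq0.
  apply: (@order_at_unique u^-1); first exact: fE.
  by exists 1, 1; split=> //; rewrite mulr1 mulVf.
by exists (DValuation fM fD f1) => x x0; apply: fE.
Qed.

End Escaping.

(** The element u from [maximal_escape] cannot map p into itself: all u^k N would be in p and u
    would be integral. So u pi is outside p for some pi in p, which is what the order function
    requires. The last clause places the valuation ring inside the localisation of O at p, with a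
    denominator T outside p. *)
Lemma maximal_ideal_valuation :
  exists v : dvaluation K,
  [/\ forall o, O o -> o != 0 -> ~ p o -> dval v o = 0,
      forall o, O o -> o != 0 -> p o -> 0 < dval v o
    & forall x, x != 0 -> 0 <= dval v x -> exists T, [/\ O T, ~ p T & O (x * T)]].
Proof.
have NK : (N%:~R : K) != 0 by rewrite numfield_intr_eq0.
have [u nuO up] := maximal_escape N0 maxp pN.
have [pi ppi npupi] : exists2 pi, p pi & ~ p (u * pi).
  apply: NNPP => nopi; apply: nuO; apply: (alg_integer_powers Fr NK) => k; apply: pO.
  elim: k => [|k IH]; first by rewrite mul1r.
  rewrite exprS -mulrA; apply: NNPP => npu; apply: nopi; by exists (u ^+ k * N%:~R).
have [v vE] := order_valuation nuO up ppi npupi.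
exists v; split=> [o oO o0 npo | o oO o0 po | x x0 vx].
- apply: (order_at_unique nuO up ppi npupi (vE o o0)).
  by exists 1, o; split=> //; rewrite !mulr1.
- suff: 1 <= dval v o by lia.
  apply: (order_at_le nuO up ppi npupi (vE o o0) O1 np1).
  by rewrite mulr1 expr1z mulrC; apply: up.
- have [T [TO npT xT]] := order_at_ge nuO up ppi npupi (vE x x0) vx.
  by exists T; split=> //; move: xT; rewrite expr0z mulr1.
Qed.

End Valuation.
End Ideals.

(** * The lattice attached to a square class *)

Lemma dval1 (K : fieldType) (v : dvaluation K) : dval v 1 = 0.
Proof.
by apply: (addrI (dval v 1)); rewrite -dvalM ?oner_neq0 // mulr1 addr0.
Qed.

Lemma dvalV (K : fieldType) (v : dvaluation K) x : x != 0 -> dval v x^-1 = - dval v x.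
Proof.
move=> x0; have xV : x^-1 != 0 by rewrite invr_eq0.
by have := dvalM v x0 xV; rewrite mulfV // dval1; lia.
Qed.

Lemma dvalX (K : fieldType) (v : dvaluation K) x k : x != 0 ->
  dval v (x ^+ k) = k%:Z * dval v x.
Proof.
move=> x0; elim: k => [|k IH]; first by rewrite expr0 dval1 mul0r.
by rewrite exprS dvalM ?expf_neq0 // IH; lia.
Qed.

(** Modulo squares this is the 2-Selmer group of K with respect to the places dividing N. The
    condition v(N) = 0 says that v is not one of them. *)
Definition selmer (K : fieldType) (N : int) (a : K) : Prop :=
  a != 0 /\ forall v : dvaluation K, dval v N%:~R = 0 ->
    exists k : int, dval v a = k + k.

Section TwistedLattice.
Variables (K : fieldExtType rat) (Fr : number_field_frame K).
Variables (a : K).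
Hypothesis a0 : a != 0.
Local Notation O := (@alg_integer (K : fieldType)).
Local Notation n := (deg Fr).

Definition sq_lattice (c : K) : Prop := O (a * c ^+ 2).
Local Notation M := sq_lattice.

(** The square of a c d is (a c^2)(a d^2), and O is integrally closed. This polarisation makes M a
    group and the twisted trace form integral on it. *)
Lemma sq_lattice_mul c d : M c -> M d -> O (a * (c * d)).
Proof.
move=> cM dM; apply: alg_integer_sqr.
have -> : (a * (c * d)) ^+ 2 = (a * c ^+ 2) * (a * d ^+ 2) by ring.
exact: alg_integerM.
Qed.

Lemma sq_latticeB c d : M c -> M d -> M (c - d).
Proof.
move=> cM dM; rewrite /sq_lattice.
have -> : a * (c - d) ^+ 2 = a * c ^+ 2 + a * d ^+ 2 - 2%:~R * (a * (c * d)) by ring.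
apply: alg_integerB; first exact: alg_integerD.
by apply: alg_integerM; [apply: alg_integer_int | apply: sq_lattice_mul].
Qed.

Lemma sq_latticeM o c : O o -> M c -> M (o * c).
Proof.
move=> oO cM; rewrite /sq_lattice exprMn mulrCA; apply: alg_integerM => //.
exact: alg_integerX.
Qed.

Lemma sq_lattice_span x : exists2 h : int, h != 0 & M (h%:~R * x).
Proof.
have [h h0 hO] := alg_integer_scale (a * x ^+ 2); exists h => //.
rewrite /sq_lattice; have -> : a * (h%:~R * x) ^+ 2 = h%:~R * (h%:~R * (a * x ^+ 2)) by ring.
by apply: alg_integerM => //; apply: alg_integer_int.
Qed.

(** The ideal generated by the a c^2, as the intersection of all ideals containing them. Membership
    can then be applied directly to an ideal of one's choice, as in [sq_lattice_quotient]. *)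
Definition sq_ideal (y : K) : Prop := forall I : K -> Prop, int_ideal I ->
  (forall c, M c -> I (a * c ^+ 2)) -> I y.

Lemma int_ideal_integers : int_ideal O.
Proof.
split=> //; first exact: (alg_integer_int K 0).
  exact: alg_integerB.
exact: alg_integerM.
Qed.

Lemma sq_ideal_ideal : int_ideal sq_ideal.
Proof.
split.
- by move=> x /(_ _ int_ideal_integers); apply.
- by move=> I [].
- move=> x y xJ yJ I idI IM; have [_ _ IB _] := idI.
  by apply: IB; [apply: xJ | apply: yJ].
- move=> o x oO xJ I idI IM; have [_ _ _ IMl] := idI.
  by apply: IMl => //; apply: xJ.
Qed.

(* At a maximal ideal p, some c in the lattice has v_p(a c^2) equal to 0 or 1,
   since otherwise the lattice could be enlarged; the value 1 is only possible
   when p divides N. *)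
Lemma sq_ideal_level (N : int) : N != 0 -> selmer N a -> sq_ideal N%:~R.
Proof.
move=> N0 [_ evenv]; apply: NNPP => nJN.
have NK : (N%:~R : K) != 0 by rewrite numfield_intr_eq0.
have [JO J0 JB JM] := sq_ideal_ideal.
have Jsq c : M c -> sq_ideal (a * c ^+ 2) by move=> cM I _; apply.
(* The quotient (J : N), where J is the ideal of the a c^2. If N is not in J it is proper, hence
   contained in a maximal ideal p; a contradiction arises from an element of I outside p. *)
pose I y := O y /\ sq_ideal (y * N%:~R).
have idI : int_ideal I.
  split.
  - by move=> x [].
  - by split; [apply: (alg_integer_int K 0) | rewrite mul0r].
  - by move=> x y [xO xJ] [yO yJ]; split; [apply: alg_integerB | rewrite mulrBl; apply: JB].
  - by move=> o x oO [xO xJ]; split; [apply: alg_integerM | rewrite -mulrA; apply: JM].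
have [c1 c10 Mc1] : exists2 c, c != 0 & M c.
  have [h h0 hM] := sq_lattice_span 1; exists h%:~R; first by rewrite numfield_intr_eq0.
  by move: hM; rewrite mulr1.
have [h h0 Ih] : exists2 h : int, h != 0 & I h%:~R.
  have b0 : a * c1 ^+ 2 != 0 by rewrite mulf_neq0 // expf_neq0.
  have [h h0 hO] := alg_integer_scale (a * c1 ^+ 2)^-1.
  exists h => //; split; first exact: alg_integer_int.
  have -> : h%:~R * N%:~R = (N%:~R * (h%:~R * (a * c1 ^+ 2)^-1)) * (a * c1 ^+ 2).
    by field; rewrite c10 a0.
  apply: (JM); last exact: Jsq.
  by apply: alg_integerM => //; apply: alg_integer_int.
have nI1 : ~ I 1 by case=> _; rewrite mul1r.
have [p maxp Ip] := exists_maximal_over Fr h0 idI Ih nI1.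
have [v [v_unit v_pos v_loc]] := maximal_ideal_valuation Fr h0 maxp (Ip _ Ih).
have v_ge0 o : O o -> o != 0 -> 0 <= dval v o.
  move=> oO o0; have [po|npo] := classic (p o); first exact/ltW/v_pos.
  by rewrite v_unit.
have [u u0 vu] : exists2 u, u != 0 & dval v u = -1.
  have [x x0 vx] := dval_normalised v.
  by exists x^-1; [rewrite invr_eq0 | rewrite dvalV // vx].
have v_sq c : c != 0 -> dval v (a * c ^+ 2) = dval v a + 2 * dval v c.
  by move=> c0; rewrite dvalM ?expf_neq0 // dvalX.
have sq0 c : c != 0 -> a * c ^+ 2 != 0 by move=> c0; rewrite mulf_neq0 ?expf_neq0.
(* While v(a c^2) is at least 2, replace c by T u c, where v(u) = -1 and T, a unit at p, clears the
   denominators away from p. The new vector is in M and the value drops by 2. *)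
have [c [c0 cM vc]] : exists c, [/\ c != 0, M c & dval v (a * c ^+ 2) < 2].
  have [k] := ubnP (absz (dval v (a * c1 ^+ 2))).
  elim: k c1 c10 Mc1 => // k IH c c0 cM ltk.
  have vc_ge0 := v_ge0 _ cM (sq0 c c0).
  have [|le2] := ltP (dval v (a * c ^+ 2)) 2; first by exists c.
  have [|T [TO npT xT]] := v_loc (a * (u * c) ^+ 2) (sq0 _ (mulf_neq0 u0 c0)).
    rewrite v_sq ?mulf_neq0 // dvalM // vu; move: le2; rewrite v_sq //; lia.
  have T0 : T != 0.
    by case: maxp => -[_ p0 _ _] _ _; apply/eqP => T0; apply: npT; rewrite T0.
  apply: (IH (T * (u * c))).
  - by rewrite !mulf_neq0.
  - rewrite /sq_lattice.
    have -> : a * (T * (u * c)) ^+ 2 = T * (a * (u * c) ^+ 2 * T) by ring.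
    exact: alg_integerM.
  - move: ltk le2; rewrite !v_sq ?mulf_neq0 // !dvalM ?mulf_neq0 // vu (v_unit T) //.
    lia.
have cJ := Jsq c cM; set b := a * c ^+ 2 in cJ vc.
have b0 : b != 0 by apply: sq0.
have [] := maxp; case=> pO _ _ _ np1 _.
have bO : O b by [].
have NO : O N%:~R by apply: alg_integer_int.
(* If b is outside p, then b itself is the required element of I, since b N is in J. Otherwise v(b)
   = 1, so v(a) is odd and v(N) > 0 by the Selmer condition; then N/b has a denominator T outside p,
   and T N is a multiple of b. *)
have [pb|npb] := classic (p b); last first.
  by apply: npb; apply: Ip; split=> //; rewrite mulrC; apply: JM.
have vb : dval v b = 1 by have := v_pos b bO b0 pb; lia.
have vN : 0 < dval v N%:~R.
  rewrite lt_neqAle v_ge0 // andbT; apply/eqP => /esym /evenv[k ak].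
  by have := v_sq c c0; rewrite -/b vb ak; lia.
have bV0 : b^-1 != 0 by rewrite invr_eq0.
have [|T [TO npT xT]] := v_loc (N%:~R / b) (mulf_neq0 NK bV0).
  by rewrite dvalM // dvalV // vb subr_ge0 -gtz0_ge1.
apply: npT; apply: Ip; split=> //.
have -> : T * N%:~R = N%:~R / b * T * b by field.
exact: JM.
Qed.

(** The y with y z^2/a integral form an ideal that contains every a c^2, because a c^2 z^2/a = (z
    c)^2. So it contains N. This bounds the elements carrying M into O in terms of a M. *)
Lemma sq_lattice_quotient (N : int) z : N != 0 -> selmer N a ->
  (forall c, M c -> O (z * c)) -> O (N%:~R * (z ^+ 2 / a)).
Proof.
move=> N0 aN zM; pose I y := O y /\ O (y * (z ^+ 2 / a)).
have idI : int_ideal I.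
  split.
  - by move=> x [].
  - by split; rewrite ?mul0r; apply: (alg_integer_int K 0).
  - move=> x y [xO xz] [yO yz]; split; first exact: alg_integerB.
    by rewrite mulrBl; apply: alg_integerB.
  - move=> o x oO [xO xz]; split; first exact: alg_integerM.
    by rewrite -mulrA; apply: alg_integerM.
suff [] : I N%:~R by [].
apply: (sq_ideal_level N0 aN) => // c cM; split=> //.
have -> : a * c ^+ 2 * (z ^+ 2 / a) = (z * c) ^+ 2 by field.
by apply: alg_integerX; apply: zM.
Qed.

End TwistedLattice.

Section BoundedDiscriminant.
Variables (K : fieldExtType rat) (Fr : number_field_frame K) (N : int).
Hypothesis N0 : N != 0.
Local Notation O := (@alg_integer (K : fieldType)).
Local Notation n := (deg Fr).

(* The dual basis, multiplied by a constant D depending on K and N only, lies in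
   the lattice, so by minimality the discriminant is at most its inverse times
   D^(2n). *)
Lemma sq_lattice_discriminant : exists B : nat, forall a : K, selmer N a ->
  exists e : 'I_n -> K, [/\ forall i, sq_lattice a (e i), \det (coord_mx e) != 0,
    forall c, sq_lattice a c -> exists z : 'I_n -> int, c = \sum_i (z i)%:~R * e i
  & `|\det (gram a e)| <= B%:R].
Proof.
have [d d0 dE] := trace_dual Fr.
pose D : int := N * d.
have D0 : D != 0 by rewrite mulf_neq0.
exists (absz D ^ n)%N => a aN; have a0 : a != 0 by case: aN.
have [e [Me e0 gen_e min_e]] := @lattice_basis K Fr a (sq_lattice a) a0
  (@sq_latticeB K a) (@sq_lattice_mul K a) (@sq_lattice_span K a).
exists e; split=> //.
(* For y in the dual of M for the form Tr(a x y), every a y c is in the inverse different, so z = d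
   a y carries M into O. Then a (N d y)^2 = N (N z^2/a) is integral: this is where D = N d comes
   from. *)
have dualM y : (forall c, sq_lattice a c -> trq Fr (a * y * c) \is a Num.int) ->
    sq_lattice a (D%:~R * y).
  move=> yint; have zM c : sq_lattice a c -> O (d%:~R * a * y * c).
    move=> cM; rewrite -!mulrA; apply: dE => o oO.
    have -> : a * (y * c) * o = a * y * (o * c) by ring.
    by apply: yint; apply: sq_latticeM.
  have := @sq_lattice_quotient K Fr a a0 N _ N0 aN zM.
  move/(alg_integerM (alg_integer_int K N)); rewrite /sq_lattice /D rmorphM /=.
  by have -> : N%:~R * (N%:~R * ((d%:~R * a * y) ^+ 2 / a)) =
    a * (N%:~R * d%:~R * y) ^+ 2 by field.
set G := gram a e.
have detG0 : \det G != 0 by rewrite det_gram_neq0.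
have Gu : G \in unitmx by rewrite unitmxE unitfE.
pose f i := \sum_j (D%:~R *: invmx G) i j *: e j.
pose f0 i := \sum_j (invmx G) i j *: e j.
have fE i : f i = D%:~R * f0 i.
  rewrite /f /f0 mulr_sumr; apply: eq_bigr => j _.
  by rewrite mxE -scalerA scaler_int mulrzl.
have tr_f0 i k : trq Fr (a * f0 i * e k) = (i == k)%:R.
  have -> : a * f0 i * e k = \sum_j (invmx G) i j *: (a * (e j * e k)).
    rewrite /f0 mulr_sumr mulr_suml; apply: eq_bigr => j _.
    by rewrite -scalerAr -scalerAl mulrA.
  rewrite trq_sum; have := mulVmx Gu => /matrixP/(_ i k); rewrite !mxE => <-.
  by apply: eq_bigr => j _; rewrite [G j k]mxE.
have Mf i : sq_lattice a (f i).
  rewrite fE; apply: dualM => c /gen_e[z ->].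
  have -> : a * f0 i * (\sum_k (z k)%:~R * e k) = \sum_k (z k)%:~R *: (a * f0 i * e k).
    rewrite mulr_sumr; apply: eq_bigr => k _.
    by rewrite scaler_int -mulrzl; ring.
  rewrite trq_sum; apply: rpred_sum => k _; rewrite tr_f0 rpredM ?intr_int //.
  exact: natr_int.
have detf : \det (gram a f) = D%:~R ^+ (2 * n) / \det G.
  rewrite (@gram_mul _ _ a e f (D%:~R *: invmx G)) // !det_mulmx det_tr detZ det_inv -/G.
  by rewrite mulnC exprM; field.
have DQ : (D%:~R : rat) != 0 by rewrite intr_eq0.
have f_indep : \det (coord_mx f) != 0.
  by rewrite -(det_gram_neq0 _ a0) detf mulf_neq0 ?invr_eq0 ?expf_neq0.
have := min_e f Mf f_indep; rewrite detf -/G normrM normfV => le1.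
have G_gt0 : 0 < `|\det G| by rewrite normr_gt0.
have : `|\det G| ^+ 2 <= ((absz D ^ n)%N%:R : rat) ^+ 2.
  rewrite expr2 -ler_pdivlMr //; apply: le_trans le1 _.
  rewrite ler_wpM2r ?invr_ge0 //.
  have DE : (absz D)%:R = `|D|%:~R :> rat by rewrite -abszE.
  by rewrite natrX -exprM mulnC normrX -intr_norm DE.
by rewrite ler_pXn2r // nnegrE.
Qed.

End BoundedDiscriminant.

(** * Finiteness modulo squares *)

(** By the Smith form the row lattice of B has index |det B|, realised as residues of r R^-1 modulo
    the diagonal entries. Among the T^n vectors with entries in [0, T) two are congruent, and their
    difference is the vector x B. *)
Lemma int_lattice_pigeonhole n (B : 'M[int]_n) (T : nat) :
  \det B != 0 -> (absz (\det B) < T ^ n)%N ->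
  exists2 x : 'rV[int]_n, x != 0 & forall j, `|(x *m B) 0 j| < T%:Z.
Proof.
move=> B0 ltB.
have [L Lu [R Ru [d _ defB]]] := int_Smith_normal_form B.
set D := (\matrix_(i, j) _) in defB.
have D_diag : D = diag_mx (\row_i d`_i).
  by apply/matrixP => i j; rewrite !mxE.
have absu (A : 'M[int]_n) : A \in unitmx -> absz (\det A) = 1%N.
  by rewrite unitmxE unitrE => /eqP dA; have := abszM (\det A) (\det A)^-1; rewrite dA; nia.
have detB : absz (\det B) = (\prod_(i < n) absz (d`_i)%R)%N.
  rewrite defB !det_mulmx !abszM (absu L) // (absu R) // mul1n muln1 D_diag det_diag.
  rewrite (big_morph absz abszM (erefl _)) //.
  by apply: eq_bigr => i _; rewrite mxE.
have d0 (i : 'I_n) : d`_i != 0.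
  apply: contraNneq B0 => di; rewrite -absz_eq0 detB (bigD1 i) //= di.
  by rewrite absz0 mul0n.
have lt_mod (i : 'I_n) (z : int) : (absz (z %% d`_i)%Z < absz (d`_i)%R)%N.
  by have := modz_ge0 z (d0 i); have := ltz_mod z (d0 i); lia.
pose row_of (t : {ffun 'I_n -> 'I_T}) : 'rV[int]_n := \row_i (t i : nat)%:Z.
pose F := {dffun forall i : 'I_n, 'I_(absz (d`_i)%R)}.
pose f t : F := [ffun i => Ordinal (lt_mod i ((row_of t *m invmx R) 0 i))].
have /injectivePn[t [t' ne_tt' ft]] : ~~ injectiveb f.
  apply/negP => /injectiveP /leq_card; rewrite card_ffun !card_ord.
  have -> : #|F| = (\prod_(i < n) absz (d`_i)%R)%N.
    rewrite card_dep_ffun foldrE big_map big_enum; apply: eq_bigr => i _; exact: card_ord.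
  by rewrite leqNgt -detB ltB.
set r := row_of t - row_of t'.
have /fin_all_exists[y yE] : forall i, exists y, (r *m invmx R) 0 i = y * d`_i.
  move=> i; apply/dvdzP; rewrite mulmxBl !mxE -eqz_mod_dvd; apply/eqP.
  have /(congr1 (fun g : F => nat_of_ord (g i))) := ft; rewrite !ffunE /= !mxE.
  move=> eq_mod; have := modz_ge0 (\sum_j row_of t 0 j * invmx R j i) (d0 i).
  have := modz_ge0 (\sum_j row_of t' 0 j * invmx R j i) (d0 i); lia.
pose x := (\row_i y i) *m invmx L.
have xB : x *m B = r.
  rewrite defB !mulmxA mulmxKV // D_diag.
  suff -> : (\row_i y i) *m diag_mx (\row_i d`_i) = r *m invmx R by rewrite mulmxKV.
  by apply/rowP => i; rewrite yE mul_mx_diag !mxE.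
exists x => [|j]; last first.
  have ltT (u v : 'I_T) : `|(u : nat)%:Z - (v : nat)%:Z| < T%:Z.
    by have := ltn_ord u; have := ltn_ord v; lia.
  by rewrite xB /r !mxE; apply: ltT.
apply: contraNneq ne_tt' => x0; apply/eqP/ffunP => i; apply/val_inj => /=.
have := xB; rewrite x0 mul0mx /r => /rowP/(_ i)/eqP.
by rewrite !mxE eq_sym subr_eq0 => /eqP[].
Qed.

Lemma rat_lattice_pigeonhole n (E : 'M[rat]_n) (A : nat) :
  (0 < n)%N -> \det E != 0 -> `|\det E| <= (A ^ n)%:R ->
  exists2 x : 'rV[int]_n, x != 0 & forall j, `|(map_mx intr x *m E) 0 j| <= A%:R.
Proof.
move=> n0 E0 leE.
pose h : int := \prod_i \prod_j denq (E i j).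
have h_gt0 : 0 < h by apply: prodr_gt0 => i _; apply: prodr_gt0 => j _.
have hE i j : exists b : int, h%:~R * E i j = b%:~R.
  have : (denq (E i j) %| h)%Z.
    by rewrite /h (bigD1 i) //= (bigD1 j) //= -mulrA dvdz_mulr.
  case/dvdzP=> k ->; exists (k * numq (E i j)).
  by rewrite !rmorphM /= -mulrA; congr (_ * _); rewrite mulrC numqE.
have /fin_all_exists[b bE] := fun i => fin_all_exists (hE i).
pose B : 'M[int]_n := \matrix_(i, j) b i j.
have BE : map_mx intr B = h%:~R *: E by apply/matrixP => i j; rewrite !mxE bE.
have detB : (\det B)%:~R = h%:~R ^+ n * \det E :> rat by rewrite -det_map_mx BE detZ.
have hQ : (h%:~R : rat) != 0 by rewrite intr_eq0 gt_eqF.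
(* With the denominators of E cleared by h, |det B| is at most (h A)^n, which is less than (h A +
   1)^n as n > 0. Entries smaller than h A + 1 are at most h A, so no loss occurs on dividing by
   h. *)
have [||x x0 xB] := @int_lattice_pigeonhole n B (absz h * A).+1.
- by rewrite -(intr_eq0 rat) detB mulf_neq0 ?expf_neq0.
- rewrite -(ltr_nat rat).
  have -> : (absz (\det B))%:R = `|(\det B)%:~R| :> rat by rewrite -intr_norm -abszE.
  have hh : (absz h)%:R = h%:~R :> rat by rewrite -[h in RHS]gtz0_abs.
  rewrite detB normrM ger0_norm ?exprn_ge0 ?ler0z ?ltW //.
  apply: (@le_lt_trans _ _ (((absz h * A) ^ n)%N%:R)).
    rewrite expnMn natrM; apply: ler_pM => //; first by rewrite exprn_ge0 ?ler0z ?ltW.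
    by rewrite natrX hh.
  by rewrite ltr_nat ltn_exp2r.
exists x => // j; have := xB j.
have -> : (map_mx intr x *m E) 0 j = ((x *m B) 0 j)%:~R / h%:~R.
  have -> : ((x *m B) 0 j)%:~R = (map_mx intr (x *m B)) 0 j :> rat by rewrite [RHS]mxE.
  rewrite map_mxM BE -scalemxAr !mxE; field.
  exact: hQ.
move=> lt_xB; rewrite normrM normfV [`|h%:~R|]ger0_norm ?ler0z ?(ltW h_gt0) //.
rewrite ler_pdivrMr ?ltr0z // -intr_norm.
have -> : A%:R * h%:~R = (A%:Z * h)%:~R :> rat by rewrite rmorphM.
rewrite ler_int; move: lt_xB; lia.
Qed.

Section SelmerFinite.
Variables (K : fieldExtType rat) (Fr : number_field_frame K).
Local Notation n := (deg Fr).
Local Notation w := (@bas K Fr).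
Local Notation s := (@emb K Fr).
Local Notation O := (@alg_integer (K : fieldType)).

Lemma deg_gt0 : (0 < n)%N.
Proof.
rewrite lt0n; apply/negP => /eqP n0; have := oner_neq0 K.
rewrite -(coordK Fr 1) /vec big1 ?eqxx // => i _.
by have := ltn_ord i; rewrite {2}n0.
Qed.

(* Scaling by a square moves an element close to 1 at all archimedean places:
   the vector of the |s_k a|^(-1/2) is fixed by complex conjugation, hence has
   real coordinates, which are then approximated by rationals. *)
Lemma archimedean_balance (a : K) : a != 0 -> exists2 b, b != 0 &
  forall k, 4%:R^-1 <= `|s k (a * b ^+ 2)| <= 4%:R.
Proof.
move=> a0; pose z k : algC := (sqrtC `|s k a|)^-1.
have sa_gt0 k : 0 < `|s k a| by rewrite normr_gt0 fmorph_eq0.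
have z_gt0 k : 0 < z k by rewrite invr_gt0 sqrtC_gt0.
have zJ k : (z k)^* = z k by apply: conj_Creal; apply: gtr0_real.
pose q := (\row_k z k) *m invmx (emb_mx Fr).
have qE k : \sum_j q 0 j * s k (w j) = z k.
  transitivity ((q *m emb_mx Fr) 0 k).
    by rewrite mxE; apply: eq_bigr => j _; rewrite [emb_mx _ _ _]mxE.
  by rewrite mulmxKV ?mxE // emb_mx_unit.
have qJ : map_mx (fun x : algC => x^*) q = q.
  apply: (can_inj (mulmxK (emb_mx_unit Fr))); apply/rowP => k.
  have [k' k'E] := @emb_conj K Fr k.
  transitivity ((\sum_j q 0 j * s k' (w j))^*).
    rewrite mxE rmorph_sum; apply: eq_bigr => j _.
    by rewrite mxE [emb_mx _ _ _]mxE rmorphM /= k'E conjCK.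
  rewrite qE mxE zJ; transitivity (z k).
    by rewrite /z k'E norm_conjC.
  by rewrite -qE; apply: eq_bigr => j _; rewrite [emb_mx _ _ _]mxE.
have q_real j : q 0 j \is Num.real.
  by rewrite CrealE; have /rowP/(_ j) := qJ; rewrite mxE => ->.
have S_ge0 : 0 <= \sum_k \sum_j 2%:R * `|s k (w j)| / z k.
  apply: sumr_ge0 => k _; apply: sumr_ge0 => j _.
  by rewrite divr_ge0 ?mulr_ge0 // ltW.
(* Rounding the coordinates to multiples of 1/h moves the k-th embedding by at most the sum of the
   |s_k(w_j)| divided by h; this h makes the error at most z_k/2 for every k. The embedding of the
   rounded vector then lies between z_k/2 and 2 z_k in absolute value, whence the bounds 1/4 and 4
   after squaring. *)
set h := (Num.bound (\sum_k \sum_j 2%:R * `|s k (w j)| / z k)).+1.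
have h_gt : \sum_k \sum_j 2%:R * `|s k (w j)| / z k <= h%:R.
  by apply: le_trans (ltW (archi_boundP S_ge0)) _; rewrite ler_nat.
have h_gt0 : 0 < h%:R :> algC by rewrite ltr0n.
pose p : 'rV[rat]_n := \row_j ((Num.floor (h%:R * q 0 j))%:~R / h%:R).
have pq j : `|ratr (p 0 j) - q 0 j| <= h%:R^-1.
  have hq_real : h%:R * q 0 j \is Num.real by rewrite rpredM ?realn.
  have /andP[f1 f2] := real_floor_itv hq_real.
  have -> : ratr (p 0 j) - q 0 j =
      - ((h%:R * q 0 j - (Num.floor (h%:R * q 0 j))%:~R) / h%:R).
    by rewrite mxE fmorph_div /= ratr_int ratr_nat; field; rewrite gt_eqF.
  rewrite normrN normrM normfV [`|h%:R|]ger0_norm ?ler0n //.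
  rewrite ler_piMl ?invr_ge0 ?ler0n // ger0_norm ?subr_ge0 //.
  by rewrite lerBlDl ltW //; move: f2; rewrite rmorphD /=.
have sz k : `|s k (vec p) - z k| <= z k / 2%:R.
  have -> : s k (vec p) - z k = \sum_j (ratr (p 0 j) - q 0 j) * s k (w j).
    rewrite emb_vec -qE mxE -sumrB; apply: eq_bigr => j _.
    by rewrite [map_mx _ _ _ _]mxE [emb_mx _ _ _]mxE -mulrBl.
  apply: le_trans (ler_norm_sum _ _ _) _.
  apply: (@le_trans _ _ (\sum_j h%:R^-1 * `|s k (w j)|)).
    by apply: ler_sum => j _; rewrite normrM; apply: ler_wpM2r.
  rewrite -mulr_sumr mulrC ler_pdivrMr // mulrAC ler_pdivlMr ?ltr0n //.
  rewrite [z k * _]mulrC -ler_pdivrMr // mulr_suml mulr_suml; apply: le_trans h_gt.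
  rewrite [leRHS](bigD1 k) //= -[leLHS]addr0 lerD //.
    apply: ler_sum => j _; by rewrite [_ * 2%:R]mulrC.
  apply: sumr_ge0 => l _; apply: sumr_ge0 => j _.
  by rewrite divr_ge0 ?mulr_ge0 // ltW.
have z2 k : `|s k a| * z k ^+ 2 = 1.
  by rewrite /z exprVn sqrtCK divff // gt_eqF.
have sb k : z k / 2%:R <= `|s k (vec p)| <= 2%:R * z k.
  have zn : `|z k| = z k by rewrite gtr0_norm.
  have half : z k - z k / 2%:R = z k / 2%:R by field.
  apply/andP; split.
    rewrite -half lerBlDr; apply: le_trans (lerD (lexx _) (sz k)).
    rewrite -{1}zn; have {1}-> : z k = s k (vec p) - (s k (vec p) - z k) by ring.
    exact: ler_normB.
  have {1}-> : s k (vec p) = z k + (s k (vec p) - z k) by ring.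
  apply: le_trans (ler_normD _ _) _; rewrite zn mulr_natl mulr2n lerD2l.
  by apply: le_trans (sz k) _; rewrite -subr_ge0 half divr_ge0 // ltW.
exists (vec p).
  apply/eqP => p0; have /andP[] := sb (Ordinal deg_gt0).
  by rewrite p0 rmorph0 normr0 pmulr_lle0 ?invr_gt0 ?ltr0n // (lt_geF (z_gt0 _)).
move=> k; have /andP[lo hi] := sb k.
rewrite rmorphM rmorphXn normrM normrX.
have a_ge0 := ltW (sa_gt0 k).
have lo2 : (z k / 2%:R) ^+ 2 <= `|s k (vec p)| ^+ 2.
  by rewrite ler_pXn2r ?nnegrE ?divr_ge0 // ltW.
have hi2 : `|s k (vec p)| ^+ 2 <= (2%:R * z k) ^+ 2.
  by rewrite ler_pXn2r ?nnegrE ?mulr_ge0 // ltW.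
apply/andP; split.
  apply: le_trans (ler_wpM2l a_ge0 lo2).
  by rewrite exprMn mulrA z2 mul1r exprVn -natrX.
apply: le_trans (ler_wpM2l a_ge0 hi2) _.
by rewrite exprMn mulrCA z2 mulr1 -natrX.
Qed.

Lemma selmer_finite_frame (N : int) : N != 0 -> exists l : seq K,
  forall a, selmer N a -> exists b c, [/\ b \in l, c != 0 & a = b * c ^+ 2].
Proof.
move=> N0; have [Bd disc_bd] := sq_lattice_discriminant Fr N0.
pose W := \det (emb_mx Fr).
have W0 : 0 < `|W|.
  by rewrite normr_gt0; have := emb_mx_unit Fr; rewrite unitmxE unitfE.
(* The Gram determinant of the basis found below is det(E)^2 W^2 times the norm of a', with E the
   coordinate matrix. It is bounded by Bd and the norm is at least 4^-n in absolute value, so X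
   bounds det(E)^2. *)
pose X : algC := Bd%:R * 4%:R ^+ n / (`|W| * `|W|).
have X_ge0 : 0 <= X by rewrite divr_ge0 ?mulr_ge0 ?exprn_ge0.
(* The successor makes A at least 1, so that det(E)^2 <= A gives |det E| <= A <= A^n. *)
pose A := (Num.bound X).+1.
have XA : X <= A%:R.
  by apply: le_trans (ltW (archi_boundP X_ge0)) _; rewrite ler_nat.
have C_ge0 : 0 <= \sum_k \sum_j A%:R * `|s k (w j)|.
  by apply: sumr_ge0 => k _; apply: sumr_ge0 => j _; rewrite mulr_ge0.
pose C := Num.bound (\sum_k \sum_j A%:R * `|s k (w j)|).
(* The lattice vector c will have coordinates at most A in absolute value, hence conjugates at most
   C; those of a' are at most 4, which bounds the conjugates of a' c^2. *)
have [l lE] := finite_bounded_integers Fr (4 * C ^ 2).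
exists l => a aN; have a0 : a != 0 by case: aN.
have [b b0 a'_bd] := archimedean_balance a0.
set a' := a * b ^+ 2 in a'_bd.
have a'0 : a' != 0 by rewrite mulf_neq0 ?expf_neq0.
have a'N : selmer N a'.
  split=> // v /(proj2 aN)[k ak]; exists (k + dval v b).
  by rewrite dvalM ?expf_neq0 // dvalX // ak; lia.
have [e [eM e0 _ e_disc]] := disc_bd a' a'N.
set E := coord_mx e in e0.
have detE_le : `|\det E| ^+ 2 <= A%:R.
  suff leX : ratr (`|\det E| ^+ 2) <= X :> algC.
    rewrite -(ler_rat algC) ratr_nat; exact: le_trans leX XA.
  have : ratr `|\det (gram a' e)| <= Bd%:R :> algC by rewrite -(ratr_nat _ Bd) ler_rat.
  rewrite det_gram normrM rmorphM /= [ratr `|\det (gram a' w)|]ratr_norm det_gram_bas.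
  rewrite !expr2 !normrM normr_prod -/W -expr2 => le1.
  rewrite /X ler_pdivlMr ?mulr_gt0 //.
  have prod_ge : (4%:R ^+ n)^-1 <= \prod_k `|s k a'|.
    rewrite -exprVn -[n in leLHS]card_ord -prodr_const.
    apply: ler_prod => k _.
    by have /andP[-> _] := a'_bd k; rewrite invr_ge0 ler0n.
  rewrite -ler_pdivrMr ?exprn_gt0 //; apply: le_trans le1.
  rewrite -mulrA; apply: ler_wpM2l; first by rewrite ler0q exprn_ge0.
  by apply: ler_wpM2l; rewrite ?mulr_ge0.
have A_gt0 : (0 < A)%N by [].
have detE_A : `|\det E| <= (A ^ n)%:R.
  apply: (@le_trans _ _ A%:R); last first.
    by rewrite ler_nat -{1}[A]expn1 leq_pexp2l // deg_gt0.
  rewrite -(ler_pXn2r (_ : 0 < 2)%N) ?nnegrE //; apply: le_trans detE_le _.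
  by rewrite -natrX ler_nat -{1}[A]expn1 leq_pexp2l.
have [x x0 xE] := rat_lattice_pigeonhole deg_gt0 e0 detE_A.
pose y := map_mx intr x *m E.
have y0 : y != 0.
  apply: contraNneq x0 => y0.
  have : map_mx intr x = 0 :> 'rV[rat]_n.
    by rewrite -(mulmxK (_ : E \in unitmx) (map_mx intr x)) -/y ?y0 ?mul0mx // unitmxE unitfE.
  move/rowP=> xr; apply/eqP/rowP => j; have := xr j; rewrite !mxE.
  by move/eqP; rewrite intr_eq0 => /eqP.
pose c := @vec K Fr y.
have c0 : c != 0.
  by apply: contraNneq y0 => c0; rewrite -[y](@vecK K Fr) -/c c0 coord0.
have cE : c = \sum_i (x 0 i)%:~R * e i.
  apply: (can_inj (coordK Fr)); rewrite /c vecK /y mulmx_sum_row.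
  have -> : \sum_i (x 0 i)%:~R * e i = \sum_i ((x 0 i)%:~R : rat) *: e i.
    by apply: eq_bigr => i _; rewrite scaler_int mulrzl.
  by rewrite coord_sum; apply: eq_bigr => i _; rewrite mxE rowK.
have cM : sq_lattice a' c.
  rewrite cE; apply: (big_ind (sq_lattice a')) => //.
  - by rewrite /sq_lattice expr0n mulr0; apply: (alg_integer_int K 0).
  - move=> c1 c2 M1 M2; rewrite -[c2]opprK; apply: sq_latticeB => //.
    by rewrite /sq_lattice sqrrN.
  - by move=> i _; apply: sq_latticeM => //; apply: alg_integer_int.
have c_bd k : `|s k c| <= C%:R.
  rewrite /c emb_vec mxE; apply: le_trans (ler_norm_sum _ _ _) _.
  apply: le_trans (ltW (archi_boundP C_ge0)).
  rewrite [leRHS](bigD1 k) //= -[leLHS]addr0 lerD //.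
    apply: ler_sum => j _; rewrite normrM [emb_mx _ _ _]mxE; apply: ler_wpM2r => //.
    by rewrite mxE -ratr_norm -(ratr_nat _ A) ler_rat; apply: xE.
  by apply: sumr_ge0 => i _; apply: sumr_ge0 => j _; rewrite mulr_ge0.
exists (a' * c ^+ 2), (b * c)^-1; split.
- apply: lE => // k; rewrite rmorphM rmorphXn normrM normrX natrM natrX.
  by apply: ler_pM; rewrite ?exprn_ge0 //; [have /andP[] := a'_bd k | rewrite ler_pXn2r ?nnegrE].
- by rewrite invr_eq0 mulf_neq0.
- by rewrite /a'; field; rewrite b0 c0.
Qed.
End SelmerFinite.

Lemma selmer_finite (K : fieldExtType rat) (N : int) : N != 0 -> exists l : seq K,
  forall a, selmer N a -> exists b c, [/\ b \in l, c != 0 & a = b * c ^+ 2].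
Proof.
have [n [w [s [wO gen_w W_unit conj_s]]]] := exists_embeddings K.
exact: (selmer_finite_frame (NumberFieldFrame wO gen_w W_unit conj_s)).
Qed.

(** * Polynomials and quadratic forms *)

Lemma base_digits_inj n B (u v : 'I_n -> nat) :
  (forall i, u i < B)%N -> (forall i, v i < B)%N ->
  (\sum_i u i * B ^ i = \sum_i v i * B ^ i)%N -> u =1 v.
Proof.
elim: n u v => [|n IH] u v uB vB; first by move=> _ [].
rewrite !big_ord_recl !muln1.
have shift (g : 'I_n.+1 -> nat) : (\sum_(i < n) g (lift ord0 i) * B ^ (lift ord0 i) =
    (\sum_(i < n) g (lift ord0 i) * B ^ i) * B)%N.
  rewrite big_distrl /=; apply: eq_bigr => i _.
  by rewrite /bump /= add1n expnSr mulnA.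
rewrite !shift => eq_uv.
have eq0 : u ord0 = v ord0.
  by have := congr1 (modn^~ B) eq_uv; rewrite /= ![(_ ord0 + _)%N]addnC !modnMDl !modn_small.
have B_gt0 : (0 < B)%N by apply: leq_ltn_trans (uB ord0).
move: eq_uv; rewrite eq0 => /addnI/eqP; rewrite eqn_pmul2r // => /eqP eqS.
move=> i; case: (unliftP ord0 i) => [j ->|-> //].
by apply: (IH (u \o lift ord0) (v \o lift ord0)) => // k /=.
Qed.

(** * Nonvanishing of polynomials in characteristic zero *)

Section InfiniteField.
Variable K : fieldType.
Hypothesis K_char0 : forall k : nat, (k.+1%:R != 0 :> K).

Lemma natK_inj : injective (fun k : nat => k%:R : K).
Proof.
move=> k l /= eq_kl; apply/eqP; case: (ltngtP k l) => // [ltkl | ltlk].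
  have := K_char0 (l - k.+1); rewrite -subSn // subSS natrB ?(ltnW ltkl) //.
  by rewrite eq_kl subrr eqxx.
have := K_char0 (k - l.+1); rewrite -subSn // subSS natrB ?(ltnW ltlk) //.
by rewrite eq_kl subrr eqxx.
Qed.

Lemma poly_nonvanishing (p : {poly K}) : p != 0 -> exists t, p.[t] != 0.
Proof.
move=> p0; apply: NNPP => no_t.
have allr : all (root p) [seq (k%:R : K) | k <- iota 0 (size p)].
  apply/allP => t _; apply: contraPT isT => pt; case: no_t; by exists t.
have uniq_r : uniq [seq (k%:R : K) | k <- iota 0 (size p)].
  by rewrite map_inj_uniq ?iota_uniq //; apply: natK_inj.
by have := max_poly_roots p0 allr uniq_r; rewrite size_map size_iota ltnn.
Qed.

(** Kronecker substitution: with B larger than every exponent in p, sending X_i to t^(B^i) keeps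
    distinct monomials distinct by uniqueness of base B digits, which reduces the claim to one
    variable. *)
Lemma mpoly_nonvanishing n (p : {mpoly K[n]}) : p != 0 -> exists x, p.@[x] != 0.
Proof.
move=> p0; pose B := msize p.
pose e (m : 'X_{1..n}) := (\sum_(i < n) m i * B ^ i)%N.
have ltB m : m \in msupp p -> forall i, (m i < B)%N.
  move=> /msize_mdeg_lt ltm i; apply: leq_ltn_trans ltm.
  by rewrite mdegE (bigD1 i) //= leq_addr.
pose P : {poly K} := \sum_(m <- msupp p) p@_m *: 'X^(e m).
have P0 : P != 0.
  have [m0 m0p] : exists m, m \in msupp p.
    by exists (mlead p); apply: mlead_supp.
  apply/eqP => /polyP/(_ (e m0)); rewrite coef0 coef_sum (bigD1_seq m0) //=.
  rewrite coefZ coefXn eqxx mulr1 big_seq_cond big1 ?addr0; last first.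
    move=> m /andP[mp nm]; rewrite coefZ coefXn; case: eqP; rewrite ?mulr0 // => em.
    case/negP: nm; apply/eqP/mnmP => i.
    exact: (base_digits_inj (ltB _ mp) (ltB _ m0p) (esym em)).
  by apply/eqP; rewrite -mcoeff_msupp.
have [t Pt] := poly_nonvanishing P0; exists (fun i => t ^+ (B ^ i)).
suff -> : p.@[fun i => t ^+ (B ^ i)] = P.[t] by [].
rewrite mevalE horner_sum; apply: eq_bigr => m _; rewrite hornerZ hornerXn.
congr (_ * _); rewrite -prodrXr; apply: eq_bigr => i _.
by rewrite -exprM mulnC.
Qed.
End InfiniteField.

(** * Dehomogenization at the coordinate of index zero *)

Section Dehomogenization.
Variables (K : fieldType) (N : nat).

Definition affine_coord (R : pzSemiRingType) (x : 'I_N -> R) (i : 'I_N.+1) : R :=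
  if unlift ord0 i is Some j then x j else 1.

Definition dehom (G : {mpoly K[N.+1]}) : {mpoly K[N]} :=
  mmap (@mpolyC N K) (affine_coord (fun j => 'X_j)) G.

HB.instance Definition _ := GRing.RMorphism.copy dehom
  (mmap (@mpolyC N K) (affine_coord (fun j => 'X_j))).

Definition mnm_tail (m : 'X_{1..N.+1}) : 'X_{1..N} := [multinom m (lift ord0 j) | j < N].

Lemma mmap1_affine (R : comNzRingType) (x : 'I_N -> R) (m : 'X_{1..N.+1}) :
  mmap1 (affine_coord x) m = mmap1 x (mnm_tail m).
Proof.
rewrite /mmap1 big_ord_recl /affine_coord unlift_none expr1n mul1r.
by apply: eq_bigr => i _; rewrite liftK mnmE.
Qed.

Lemma dehomE G : dehom G = \sum_(m <- msupp G) G@_m *: 'X_[mnm_tail m].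
Proof.
rewrite /dehom /mmap; apply: eq_bigr => m _.
by rewrite mmap1_affine mmap1_id mul_mpolyC.
Qed.

Lemma mmap_dehom (R : comNzRingType) (h : {rmorphism K -> R}) (x : 'I_N -> R) G :
  mmap h (affine_coord x) G = mmap h x (dehom G).
Proof.
rewrite dehomE raddf_sum /mmap; apply: eq_bigr => m _ /=.
by rewrite -/(mmap _ _ _) mmapZ mmapX mmap1_affine.
Qed.

Lemma mdeg_tail (m : 'X_{1..N.+1}) : mdeg m = (m ord0 + mdeg (mnm_tail m))%N.
Proof.
rewrite !mdegE big_ord_recl; congr (_ + _)%N.
by apply: eq_bigr => i _; rewrite mnmE.
Qed.

(** In a fixed degree the exponent of X_0 is determined by the other exponents, so setting X_0 = 1
    merges no monomials. *)
Lemma dehom_inj d G : G \is d.-homog -> dehom G = 0 -> G = 0.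
Proof.
move=> /dhomogP Gd G0; apply/mpolyP => m0; rewrite mcoeff0.
have [m0G|/memN_msupp_eq0 //] := boolP (m0 \in msupp G).
have := congr1 (mcoeff (mnm_tail m0)) G0.
rewrite dehomE mcoeff0 raddf_sum (bigD1_seq m0) //= mcoeffZ mcoeffX eqxx mulr1.
rewrite big_seq_cond big1 ?addr0 // => m /andP[mG nm].
rewrite mcoeffZ mcoeffX; case: eqP; rewrite ?mulr0 // => eq_tail.
case/negP: nm; apply/eqP/mnmP => i; case: (unliftP ord0 i) => [j ->|->].
  by have := congr1 (fun m : 'X_{1..N} => m j) eq_tail; rewrite !mnmE.
have := Gd _ mG; have := Gd _ m0G; rewrite /= !mdeg_tail eq_tail => <- /eqP.
by rewrite eqn_add2r => /eqP.
Qed.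

(** The degree d is free above a bound, so that several polynomials can be homogenized to a common
    degree or to prescribed ones. *)
Lemma exists_homogenization (P : {mpoly K[N]}) d : (msize P <= d)%N ->
  exists2 G, G \is d.-homog & dehom G = P.
Proof.
move=> leP.
pose hm (m : 'X_{1..N}) : 'X_{1..N.+1} :=
  [multinom (if unlift ord0 i is Some j then m j else d - mdeg m)%N | i < N.+1].
have tail_hm m : mnm_tail (hm m) = m.
  by apply/mnmP => j; rewrite !mnmE liftK.
exists (\sum_(m <- msupp P) P@_m *: 'X_[hm m]).
  rewrite big_seq; apply: rpred_sum => m /msize_mdeg_lt ltm.
  apply: rpredZ; rewrite dhomogX /= mdeg_tail tail_hm mnmE unlift_none subnK //.
  exact: leq_trans (ltnW ltm) leP.
rewrite [RHS]mpolyE raddf_sum; apply: eq_bigr => m _ /=.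
by rewrite /dehom mmapZ mmapX mmap1_affine mmap1_id tail_hm mul_mpolyC.
Qed.

End Dehomogenization.

(** * Quadratic forms and their polar forms *)

Section QuadraticForm.
Variables (K : fieldType) (n : nat).

Definition quad_form (a : 'I_n -> 'I_n -> K) : {mpoly K[n]} :=
  \sum_i \sum_j a i j *: ('X_i * 'X_j).

Lemma exists_quad_form f : f \is 2.-homog -> exists a, f = quad_form a.
Proof.
move=> /dhomogP f2; rewrite [f]mpolyE big_seq.
apply: (big_ind (fun g => exists a, g = quad_form a)).
- exists (fun _ _ => 0); rewrite /quad_form; rewrite big1 // => i _.
  by rewrite big1 // => j _; rewrite scale0r.
- move=> _ _ [a ->] [b ->]; exists (fun i j => a i j + b i j).
  rewrite /quad_form -big_split; apply: eq_bigr => i _; rewrite -big_split.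
  by apply: eq_bigr => j _; rewrite scalerDl.
- move=> m /f2 /= m2.
  have [i mi] : exists i, m i != 0%N.
    apply: NNPP => no_i; move: m2; rewrite /= mdegE big1 // => i _.
    by apply/eqP; apply: contraPT isT => mi; case: no_i; exists i.
  have m2' : mdeg (m - U_(i))%MM = 1%N.
    have := congr1 (@mdeg n) (submK (_ : U_(i) <= m)%MM); rewrite lep1mP => /(_ mi).
    by rewrite mdegD mdeg1 m2 addn1 => -[].
  have /mdeg1P[j /eqP mj] : mdeg (m - U_(i))%MM == 1%N by rewrite m2'.
  have mE : m = (U_(j) + U_(i))%MM by rewrite -mj submK // lep1mP.
  exists (fun k l => f@_m *+ ((k == j) && (l == i))).
  rewrite /quad_form (bigD1 j) //= [X in _ + X]big1 => [|k /negbTE kj]; last first.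
    by rewrite big1 // => l _; rewrite kj scale0r.
  rewrite (bigD1 i) //= big1 => [|l /negbTE li]; last by rewrite li andbF scale0r.
  by rewrite !eqxx !addr0 mulr1n {2}mE mpolyXD.
Qed.

Lemma quad_formE a (x : 'I_n -> K) : (quad_form a).@[x] = \sum_i \sum_j a i j * (x i * x j).
Proof.
rewrite raddf_sum; apply: eq_bigr => i _; rewrite raddf_sum; apply: eq_bigr => j _ /=.
by rewrite mevalZ mevalM !mevalXU.
Qed.

Lemma mderivXU i k : ('X_i : {mpoly K[n]})^`M(k) = (i == k)%:R%:MP.
Proof.
rewrite mderivX mnm1E; case: eqP => [->|_]; last by rewrite scale0r mpolyC0.
by rewrite scale1r -{1}[U_(k)%MM]add0m addmK mpolyX0.
Qed.

Lemma quad_form_deriv a k (x : 'I_n -> K) :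
  ((quad_form a)^`M(k)).@[x] = \sum_j (a k j + a j k) * x j.
Proof.
transitivity (\sum_i \sum_j (a i j * (i == k)%:R * x j + a i j * x i * (j == k)%:R)).
  rewrite /quad_form (big_morph (mderiv k) (mderivD k) (mderiv0 _ k)).
  rewrite (big_morph (meval x) (mevalD x) (meval0 x)); apply: eq_bigr => i _.
  rewrite (big_morph (mderiv k) (mderivD k) (mderiv0 _ k)).
  rewrite (big_morph (meval x) (mevalD x) (meval0 x)); apply: eq_bigr => j _.
  rewrite mderivZ mevalZ mderivM !mderivXU mevalD !mevalM !mevalC !mevalXU; ring.
under eq_bigr => i _ do rewrite big_split /=.
rewrite big_split /=; under [RHS]eq_bigr => j _ do rewrite mulrDl.
rewrite [RHS]big_split /=; congr (_ + _).
  rewrite (bigD1 k) //= [X in _ + X]big1 ?addr0 => [|i /negbTE ik].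
    by apply: eq_bigr => j _; rewrite eqxx mulr1.
  by rewrite big1 // => j _; rewrite ik mulr0 mul0r.
apply: eq_bigr => i _; rewrite (bigD1 k) //= big1 ?addr0 => [|j /negbTE jk].
  by rewrite eqxx mulr1.
by rewrite jk mulr0.
Qed.

(** The bilinear form f(u+v) - f(u) - f(v), written through the gradient at v to connect it with the
    Jacobian criterion. *)
Definition polar a (u v : 'I_n -> K) : K := \sum_k u k * ((quad_form a)^`M(k)).@[v].

Lemma polarE a (u v : 'I_n -> K) :
  polar a u v = \sum_i \sum_j a i j * (u i * v j + v i * u j).
Proof.
rewrite /polar.
under eq_bigr => k _ do rewrite quad_form_deriv mulr_sumr.
under [RHS]eq_bigr => i _.
  rewrite (eq_bigr (fun j => a i j * (u i * v j) + a i j * (v i * u j))); last first.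
    by move=> j _; rewrite mulrDr.
  rewrite big_split /=; over.
rewrite big_split /= [X in _ + X]exchange_big -big_split; apply: eq_bigr => i _ /=.
by rewrite -big_split; apply: eq_bigr => j _ /=; ring.
Qed.

Lemma quad_form_line a (u v : 'I_n -> K) (s : K) :
  (quad_form a).@[fun i => u i + s * v i] =
    (quad_form a).@[u] + s * polar a u v + s ^+ 2 * (quad_form a).@[v].
Proof.
rewrite polarE !quad_formE !mulr_sumr -!big_split; apply: eq_bigr => i _ /=.
rewrite !mulr_sumr -!big_split; apply: eq_bigr => j _ /=; ring.
Qed.

Lemma polar_linear a (u v : 'I_n -> K) :
  polar a u v = \sum_j (\sum_k u k * (a k j + a j k)) * v j.
Proof.
rewrite /polar; under eq_bigr => k _ do rewrite quad_form_deriv mulr_sumr.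
rewrite exchange_big; apply: eq_bigr => j _ /=; rewrite mulr_suml.
by apply: eq_bigr => k _; rewrite mulrA.
Qed.
End QuadraticForm.

(** Q^2 divides R^2, so Q divides R and F = b S^2 with S of degree at most 1. The conclusion is the
    vanishing of the discriminant of F. *)
Lemma quadratic_poly_square (K : fieldType) (F Q R : {poly K}) b :
  b != 0 -> Q != 0 -> (size F <= 3)%N -> F * Q ^+ 2 = b *: R ^+ 2 ->
  F`_1 ^+ 2 = 4%:R * F`_0 * F`_2.
Proof.
move=> b0 Q0 sF eqF.
have /dvdpP[S RE] : Q %| R.
  rewrite -(dvdp_pexp2r _ _ (isT : 0 < 2)%N) -(dvdpZr _ _ b0) -eqF dvdp_mulIr //.
have FE : F = b *: S ^+ 2.
  apply: (mulIf (expf_neq0 2 Q0)); rewrite eqF RE exprMn -scalerAl //.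
have sS : (size S <= 2)%N.
  have [->|S0] := eqVneq S 0; first by rewrite size_poly0.
  move: sF; rewrite FE size_scale // expr2 size_mul //; move: (size S) => k; lia.
have SE : S = (S`_0)%:P + (S`_1)%:P * 'X.
  apply/polyP => i; rewrite coefD coefC coefMX coefC.
  by case: i => [|[|i]]; rewrite ?addr0 ?add0r //= nth_default // (leq_trans sS).
have -> : F = (b * (S`_0 * S`_0))%:P + (b * (S`_0 * S`_1) + b * (S`_0 * S`_1))%:P * 'X
    + (b * (S`_1 * S`_1))%:P * 'X^2.
  rewrite FE {1}SE -mul_polyC polyCD !polyCM; ring.
rewrite !coefD !coefC !coefMX !coefCM !coefC !coefXn /=; ring.
Qed.

Definition line_eval (K : fieldType) n (u v : 'I_n -> K) (p : {mpoly K[n]}) : {poly K} :=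
  mmap (@polyC K) (fun i => (u i)%:P + (v i)%:P * 'X) p.

HB.instance Definition _ (K : fieldType) n (u v : 'I_n -> K) :=
  GRing.RMorphism.copy (line_eval u v)
    (mmap (@polyC K) (fun i => (u i)%:P + (v i)%:P * 'X)).

Lemma line_evalE (K : fieldType) n (u v : 'I_n -> K) p s :
  (line_eval u v p).[s] = p.@[fun i => u i + s * v i].
Proof.
rewrite /line_eval /mmap mevalE horner_sum; apply: eq_bigr => m _.
rewrite hornerM hornerC; congr (_ * _); rewrite horner_prod; apply: eq_bigr => i _.
by rewrite horner_exp !hornerE mulrC.
Qed.

(* If f q^2 = b p^2, then f is a square on a general line, which says that the
   polar form satisfies B(u, v)^2 = 4 f(u) f(v); a vector v orthogonal to a
   general u is then a singular zero of f. *)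
Lemma smooth_quadric_not_square (K : fieldType) N (f p q : {mpoly K[N.+2]}) b :
  (forall k : nat, k.+1%:R != 0 :> K) ->
  smooth_quadric f -> b != 0 -> q != 0 -> f * q ^+ 2 != b *: p ^+ 2.
Proof.
move=> K0 [f2 f_smooth] b0 q0; apply/eqP => eq_f.
have [a fE] := exists_quad_form f2.
have f_smoothK v : (exists i, v i != 0) -> f.@[v] = 0 -> exists k, (f^`M(k)).@[v] != 0.
  exact: (f_smooth K idfun v).
have f0 : f != 0.
  apply/eqP => f0; have [||k] := f_smoothK (fun _ => 1).
  - by exists ord0; rewrite oner_neq0.
  - by rewrite f0 meval0.
  - by rewrite f0 mderiv0 meval0 eqxx.
have disc u v : q.@[u] != 0 -> polar a u v ^+ 2 = 4%:R * f.@[u] * f.@[v].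
  move=> qu.
  have fl : line_eval u v f =
      (f.@[u])%:P + (polar a u v)%:P * 'X + (f.@[v])%:P * 'X^2.
    apply/eqP; rewrite -subr_eq0; apply: contraPT isT => /(poly_nonvanishing K0)[t].
    rewrite hornerD hornerN line_evalE !(hornerD, hornerM, hornerC, hornerX, hornerXn) fE quad_form_line.
    set y := (X in X != 0); have -> : y = 0 by rewrite /y; ring.
    by rewrite eqxx.
  have lq0 : line_eval u v q != 0.
    apply: contraNneq qu => lq; have := line_evalE u v q 0.
    rewrite lq horner0 => ->; apply/eqP; apply: meval_eq => i.
    by rewrite mul0r addr0.
  have eq_l : line_eval u v f * line_eval u v q ^+ 2 = b *: line_eval u v p ^+ 2.
    rewrite -!rmorphXn -rmorphM eq_f /=.
    by rewrite /line_eval mmapZ mul_polyC.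
  have sF : (size (line_eval u v f) <= 3)%N.
    rewrite fl; apply: leq_trans (size_polyD _ _) _; rewrite geq_max; apply/andP; split.
      apply: leq_trans (size_polyD _ _) _; rewrite geq_max; apply/andP; split.
        by apply: leq_trans (size_polyC_leq1 _) _.
      apply: leq_trans (size_polyMleq _ _) _; rewrite size_polyX addn2 /=.
      exact: leq_trans (size_polyC_leq1 _) _.
    apply: leq_trans (size_polyMleq _ _) _; rewrite size_polyXn addn3 /=.
    exact: size_polyC_leq1.
  have := quadratic_poly_square b0 lq0 sF eq_l.
  rewrite fl !coefD !coefC !coefMX !coefCM !coefC !coefXn /=.
  by rewrite !(addr0, add0r, mulr0, mulr1).
have [u qfu] : exists u, (q * f).@[u] != 0.
  by apply: mpoly_nonvanishing => //; rewrite mulf_neq0.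
move: qfu; rewrite mevalM mulf_eq0 negb_or => /andP[qu fu].
have [c polE] : exists c, forall v, polar a u v = \sum_j c j * v j.
  by eexists => v; apply: polar_linear.
(* A linear form in at least two variables has a nontrivial zero; it is built from the first two
   coefficients. *)
have [v v0 uv] : exists2 v : 'I_N.+2 -> K, (exists i, v i != 0) & polar a u v = 0.
  pose i1 : 'I_N.+2 := lift ord0 ord0.
  have [c0|c0] := eqVneq (c ord0) 0.
    exists (fun j => (j == ord0)%:R); first by exists ord0; rewrite eqxx oner_neq0.
    rewrite polE (bigD1 ord0) //= big1 ?addr0 => [|j /negbTE ->]; last first.
      by rewrite mulr0.
    by rewrite c0 mul0r.
  exists (fun j => if j == ord0 then c i1 else if j == i1 then - c ord0 else 0).
    by exists i1; rewrite /= oppr_eq0.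
  rewrite polE (bigD1 ord0) //= (bigD1 i1) //= big1 ?addr0; last first.
    by move=> j /andP[/negbTE -> /negbTE ->]; rewrite mulr0.
  by ring.
have fv : f.@[v] = 0.
  have /eqP := disc u v qu; rewrite uv expr0n /= eq_sym !mulf_eq0 (negbTE fu) orbF.
  by rewrite (negbTE (K0 3%N)) => /eqP.
have [k] := f_smoothK v v0 fv; apply/negP; rewrite negbK.
(* The linear form B(w, v) in w, whose coefficients are the partial derivatives of f at v. As f(v) =
   0, its square vanishes wherever q does not, so q g is zero everywhere and g = 0. *)
pose g : {mpoly K[N.+2]} := \sum_k ((f^`M(k)).@[v]) *: 'X_k.
have gE w : g.@[w] = polar a w v.
  rewrite /g (big_morph (meval w) (mevalD w) (meval0 w)) /polar fE.
  by apply: eq_bigr => l _; rewrite mevalZ mevalXU mulrC.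
have g0 : g = 0.
  apply/eqP; apply: contraPT isT => g0.
  have [w] := mpoly_nonvanishing K0 (mulf_neq0 q0 g0).
  rewrite mevalM mulf_eq0 negb_or => /andP[qw]; rewrite gE => /negP[].
  by have /eqP := disc w v qw; rewrite fv mulr0 sqrf_eq0.
have := congr1 (meval (fun i => (i == k)%:R)) g0.
rewrite meval0 /g (big_morph (meval _) (mevalD _) (meval0 _)) (bigD1 k) //=.
rewrite mevalZ mevalXU eqxx mulr1 big1 ?addr0 => [-> //|i /negbTE ik].
by rewrite mevalZ mevalXU ik mulr0.
Qed.

(** * Quadratic extensions and double covers *)

Lemma fraction_numden (R : idomainType) (x : {fraction R}) :
  exists n d : R, d != 0 /\ x = tofrac n / tofrac d.
Proof.
elim/quotW: x => x; exists (frac x).1, (frac x).2.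
have dx := denom_ratioP x; split=> //.
apply: (canRL (mulfK _)); first by rewrite tofrac_eq0.
rewrite -[_ * _]/(FracField.mul _ _) !piE; apply/eqmodP.
rewrite /= FracField.equivfE !numden_Ratio ?mulf_neq0 //.
  by rewrite !mulr1 mulrC.
all: exact: oner_neq0.
Qed.

(* The field F(sqrt D), whose element (x, y) stands for x + y sqrt D. *)
Section QuadraticExtension.
Variables (F : fieldType) (D : F).
Hypothesis nsqD : forall z : F, z ^+ 2 != D.

(** The proof that D is not a square is an argument of the type, so that the type alone determines
    its field structure. *)
Definition quad_ext of (forall z : F, z ^+ 2 != D) : Type := (F * F)%type.
Local Notation L := (quad_ext nsqD).

HB.instance Definition _ := GRing.Zmodule.copy L (F * F)%type.

Implicit Types x y z : L.

Definition quad_one : L := (1, 0).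
Definition quad_mul x y : L := (x.1 * y.1 + D * (x.2 * y.2), x.1 * y.2 + x.2 * y.1).
Definition quad_norm x : F := x.1 ^+ 2 - D * x.2 ^+ 2.
Definition quad_inv x : L := (x.1 / quad_norm x, - x.2 / quad_norm x).

Lemma quad_eq x y : x.1 = y.1 -> x.2 = y.2 -> x = y.
Proof. by case: x y => [? ?] [? ?] /= -> ->. Qed.

Lemma quad_mulA : associative quad_mul.
Proof. by move=> x y z; apply: quad_eq => /=; ring. Qed.
Lemma quad_mulC : commutative quad_mul.
Proof. by move=> x y; apply: quad_eq => /=; ring. Qed.
Lemma quad_mul1 : left_id quad_one quad_mul.
Proof. by move=> x; apply: quad_eq => /=; ring. Qed.
Lemma quad_mulD : left_distributive quad_mul +%R.
Proof. by move=> x y z; apply: quad_eq => /=; ring. Qed.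
Lemma quad_one_neq0 : quad_one != 0.
Proof. by apply/eqP => -[/eqP]; rewrite oner_eq0. Qed.

HB.instance Definition _ := GRing.Zmodule_isComNzRing.Build L
  quad_mulA quad_mulC quad_mul1 quad_mulD quad_one_neq0.

Lemma quad_norm_neq0 x : x != 0 -> quad_norm x != 0.
Proof.
move=> x0; apply: contraNneq x0 => /eqP; rewrite subr_eq0 => /eqP normx.
have [x20|x20] := eqVneq x.2 0; last first.
  have := nsqD (x.1 / x.2); rewrite exprMn normx exprVn mulfK ?expf_neq0 //.
  by rewrite eqxx.
move: normx; rewrite x20 expr0n /= mulr0 => /eqP; rewrite sqrf_eq0 => /eqP x10.
by apply/eqP; apply: quad_eq.
Qed.

Lemma quad_mulVf x : x != 0 -> quad_inv x * x = 1.
Proof.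
move=> /quad_norm_neq0 nx; apply: quad_eq => /=; rewrite /quad_norm in nx *; field => //.
Qed.

Lemma quad_inv0 : quad_inv 0 = 0.
Proof. by apply: quad_eq => /=; rewrite ?oppr0 mul0r. Qed.

HB.instance Definition _ := GRing.ComNzRing_isField.Build L quad_mulVf quad_inv0.

Definition quad_const (c : F) : L := (c, 0).

Lemma quad_const_is_zmod_morphism : zmod_morphism quad_const.
Proof. by move=> c d; apply: quad_eq => //=; rewrite subr0. Qed.
Lemma quad_const_is_monoid_morphism : monoid_morphism quad_const.
Proof. by split=> // c d; apply: quad_eq => /=; ring. Qed.

HB.instance Definition _ := GRing.isZmodMorphism.Build F L quad_const
  quad_const_is_zmod_morphism.
HB.instance Definition _ := GRing.isMonoidMorphism.Build F L quad_const
  quad_const_is_monoid_morphism.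

Definition quad_root : L := (0, 1).

Lemma quad_root_sqr : quad_root ^+ 2 = quad_const D.
Proof. by rewrite expr2; apply: quad_eq => /=; ring. Qed.

Lemma quad_decomp x : x = quad_const x.1 + quad_const x.2 * quad_root.
Proof. by apply: quad_eq => /=; ring. Qed.

End QuadraticExtension.

(** * Finitely generated subalgebras *)

Section GeneratedAlgebra.
Variables (K L : fieldType) (h : {rmorphism K -> L}) (g : seq L).

Lemma gen_alg_const c : gen_alg h g (h c).
Proof. by exists c%:MP; rewrite mmapC. Qed.

Lemma gen_algD a b : gen_alg h g a -> gen_alg h g b -> gen_alg h g (a + b).
Proof. by case=> P -> [Q ->]; exists (P + Q); rewrite mmapD. Qed.

Lemma gen_algM a b : gen_alg h g a -> gen_alg h g b -> gen_alg h g (a * b).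
Proof. by case=> P -> [Q ->]; exists (P * Q); rewrite rmorphM. Qed.

Lemma gen_alg_gen a : a \in g -> gen_alg h g a.
Proof.
move=> ag; have lt_i : (index a g < size g)%N by rewrite index_mem.
by exists 'X_(Ordinal lt_i); rewrite mmapX mmap1U nth_index.
Qed.

Lemma gen_alg_mmap n (x : 'I_n -> L) P :
  (forall i, x i \in g) -> gen_alg h g (mmap h x P).
Proof.
have g0 : gen_alg h g 0 by rewrite -(rmorph0 h); apply: gen_alg_const.
have g1 : gen_alg h g 1 by rewrite -(rmorph1 h); apply: gen_alg_const.
move=> xg; rewrite /mmap; apply: big_ind => // [|m _]; first exact: gen_algD.
apply: gen_algM; first exact: gen_alg_const.
rewrite /mmap1; apply: big_ind => // [|i _]; first exact: gen_algM.
elim: (m i) => [|k IH]; first by rewrite expr0.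
by rewrite exprS; apply: gen_algM => //; apply: gen_alg_gen.
Qed.

Lemma gen_alg_ind (P : L -> Prop) :
  (forall c, P (h c)) -> (forall a b, P a -> P b -> P (a + b)) ->
  (forall a b, P a -> P b -> P (a * b)) -> (forall a, a \in g -> P a) ->
  forall z, gen_alg h g z -> P z.
Proof.
move=> Pc PD PM Pg z [Q ->].
have P0 : P 0 by rewrite -(rmorph0 h).
have P1 : P 1 by rewrite -(rmorph1 h).
rewrite /mmap; apply: big_ind => // m _; apply: (PM); first exact: Pc.
rewrite /mmap1; apply: big_ind => // i _.
elim: (m i) => [|k IH]; first by rewrite expr0.
by rewrite exprS; apply: (PM) => //; apply: Pg; apply: mem_nth.
Qed.
End GeneratedAlgebra.

Lemma add_fractions (F : fieldType) (a b c d z : F) : c != 0 -> d != 0 ->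
  a / c + b / d * z = (a * d + b * c * z) / (c * d).
Proof. by move=> c0 d0; field; rewrite d0 c0. Qed.

Lemma quadratic_equation (F : fieldType) (a b c z : F) : c != 0 ->
  c ^+ 2 * ((a + b * z) / c) ^+ 2 - (a * c + a * c) * ((a + b * z) / c)
    + (a ^+ 2 - b ^+ 2 * z ^+ 2) = 0.
Proof. by move=> c0; field. Qed.

(* The double cover y^2 = D of the affine space X_0 <> 0, with a single chart:
   the points at infinity belong to the thin set X_0 = 0 anyway. *)
Section DoubleCover.
Variables (K : fieldType) (N : nat) (D : {mpoly K[N]}).
Local Notation F := {fraction {mpoly K[N]}}.
Variables (L : fieldType) (frac_in : {rmorphism F -> L}) (y : L).
Hypothesis y_sqr : y ^+ 2 = frac_in (tofrac D).
Hypothesis L_gen : forall z, exists a b, z = frac_in a + frac_in b * y.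
Hypothesis L_free : forall a b, frac_in a + frac_in b * y = 0 -> a = 0 /\ b = 0.

Definition poly_in (P : {mpoly K[N]}) : L := frac_in (tofrac P).
HB.instance Definition _ := GRing.RMorphism.copy poly_in
  (frac_in \o @tofrac {mpoly K[N]}).

Definition const_in (c : K) : L := poly_in c%:MP.
HB.instance Definition _ := GRing.RMorphism.copy const_in
  (poly_in \o @mpolyC N K).

Definition cover_coord (j : 'I_N) : L := poly_in 'X_j.
Local Notation x := cover_coord.

Lemma poly_in_inj : injective poly_in.
Proof.
by move=> P Q /(fmorph_inj frac_in) /eqP; rewrite tofrac_eq => /eqP.
Qed.

Lemma poly_inE P : poly_in P = mmap const_in x P.
Proof.
rewrite {1}[P]mpolyE (big_morph poly_in (rmorphD poly_in) (rmorph0 poly_in)).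
rewrite /mmap; apply: eq_bigr => m _.
rewrite -mul_mpolyC rmorphM /=; congr (_ * _).
rewrite mpolyXE_id (big_morph poly_in (rmorphM poly_in) (rmorph1 poly_in)) /mmap1.
by apply: eq_bigr => i _; rewrite rmorphXn.
Qed.

Lemma root_sqr : y ^+ 2 = poly_in D.
Proof. exact: y_sqr. Qed.

Definition elt (P Q : {mpoly K[N]}) : L := poly_in P + poly_in Q * y.

Lemma elt_inj P Q P' Q' : elt P Q = elt P' Q' -> P = P' /\ Q = Q'.
Proof.
move/eqP; rewrite -subr_eq0 /elt.
have -> : poly_in P + poly_in Q * y - (poly_in P' + poly_in Q' * y) =
    frac_in (tofrac (P - P')) + frac_in (tofrac (Q - Q')) * y.
  by rewrite -!/(poly_in _) !rmorphB; ring.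
move/eqP/L_free => -[/eqP + /eqP]; rewrite !tofrac_eq0 !subr_eq0.
by move=> /eqP -> /eqP ->.
Qed.

Lemma eltD P Q P' Q' : elt P Q + elt P' Q' = elt (P + P') (Q + Q').
Proof. by rewrite /elt !rmorphD /=; ring. Qed.

Lemma eltM P Q P' Q' : elt P Q * elt P' Q' = elt (P * P' + D * (Q * Q')) (P * Q' + Q * P').
Proof. by rewrite /elt !rmorphD !rmorphM /= -root_sqr; ring. Qed.

Lemma elt_const P : elt P 0 = poly_in P.
Proof. by rewrite /elt rmorph0 mul0r addr0. Qed.

Lemma elt_frac z : exists A B C, C != 0 /\ z = elt A B / poly_in C.
Proof.
have [u [v ->]] := L_gen z.
have [n [d [d0 ->]]] := fraction_numden u.
have [n' [d' [d'0 ->]]] := fraction_numden v.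
exists (n * d'), (n' * d), (d * d'); split; first exact: mulf_neq0.
have pd : poly_in d != 0 by rewrite -(rmorph0 poly_in) (inj_eq poly_in_inj).
have pd' : poly_in d' != 0 by rewrite -(rmorph0 poly_in) (inj_eq poly_in_inj).
by rewrite !fmorph_div -!/(poly_in _) add_fractions // /elt !rmorphM.
Qed.

Definition cover_gens : seq L := y :: [seq x j | j : 'I_N].

Lemma cover_algP z : gen_alg const_in cover_gens z <-> exists P Q, z = elt P Q.
Proof.
split.
  apply: (@gen_alg_ind K L const_in _ (fun z => exists P Q, z = elt P Q)).
  - by move=> c; exists c%:MP, 0; rewrite elt_const.
  - by move=> _ _ [P [Q ->]] [P' [Q' ->]]; rewrite eltD; do 2 eexists.
  - by move=> _ _ [P [Q ->]] [P' [Q' ->]]; rewrite eltM; do 2 eexists.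
  - move=> a; rewrite inE => /orP[/eqP ->|/imageP[j _ ->]].
      by exists 0, 1; rewrite /elt rmorph0 rmorph1 add0r mul1r.
    by exists 'X_j, 0; rewrite elt_const.
have xg i : x i \in cover_gens by rewrite inE image_f ?orbT.
case=> P [Q ->]; rewrite /elt !poly_inE; apply: gen_algD; first exact: gen_alg_mmap.
by apply: gen_algM; [apply: gen_alg_mmap | apply: gen_alg_gen; rewrite inE eqxx].
Qed.

Lemma poly_in_alg P : gen_alg const_in cover_gens (poly_in P).
Proof. by apply/cover_algP; exists P, 0; rewrite elt_const. Qed.

Lemma cover_nonempty : [:: cover_gens] <> [::]. Proof. by []. Qed.

Lemma cover_fractions g : g \in [:: cover_gens] -> forall z, exists a b,
  [/\ gen_alg const_in g a, gen_alg const_in g b, b != 0 & z = a / b].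
Proof.
rewrite inE => /eqP -> z; have [A [B [C [C0 ->]]]] := elt_frac z.
exists (elt A B), (poly_in C); split=> //.
- by apply/cover_algP; exists A, B.
- exact: poly_in_alg.
- by rewrite -(rmorph0 poly_in) (inj_eq poly_in_inj).
Qed.

Lemma cover_glue g h : g \in [:: cover_gens] -> h \in [:: cover_gens] ->
  forall q, prime_of (gen_alg const_in (g ++ h)) q ->
  forall z, local_ring (gen_alg const_in g) q z <-> local_ring (gen_alg const_in h) q z.
Proof. by rewrite !inE => /eqP -> /eqP ->. Qed.

Definition double_cover : variety K :=
  @Variety K L const_in [:: cover_gens] cover_nonempty cover_fractions cover_glue.

Definition cover_map : 'I_N.+1 -> vfield double_cover := affine_coord x.

Lemma cover_mapE G : mmap (vin double_cover) cover_map G = poly_in (dehom G).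
Proof. by rewrite poly_inE -mmap_dehom. Qed.

Lemma cover_map_alg k : gen_alg const_in cover_gens (cover_map k).
Proof.
rewrite /cover_map /affine_coord; case: (unlift _ _) => [j|]; first exact: poly_in_alg.
by rewrite -(rmorph1 poly_in); apply: poly_in_alg.
Qed.

Lemma cover_map0 : cover_map ord0 = 1.
Proof. by rewrite /cover_map /affine_coord unlift_none. Qed.

Lemma double_cover_dim : variety_dim double_cover N.
Proof.
exists x; split.
  move=> P; rewrite -poly_inE => /eqP.
  by rewrite -(rmorph0 poly_in) (inj_eq poly_in_inj) => /eqP.
move=> z; have [A [B [C [C0 zE]]]] := elt_frac z.
(* The quadratic equation of (A + B y)/C over K(X), multiplied by C^2; see [quadratic_equation]. *)
pose G : {poly {mpoly K[N]}} := (C ^+ 2)%:P * 'X^2 + (- (A * C + A * C))%:P * 'X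
  + (A ^+ 2 - B ^+ 2 * D)%:P.
exists G.
  apply: contraNneq C0 => G0; have := congr1 (fun p : {poly _} => p`_2) G0.
  rewrite coef0 /G !coefD !coefC coefCM coefXn coefMX coefC /= mulr1 !addr0.
  by move=> /eqP; rewrite sqrf_eq0.
have -> : map_poly (mmap (vin double_cover) x) G = map_poly poly_in G.
  by apply: eq_map_poly => P; rewrite poly_inE.
rewrite /G !(rmorphD (map_poly poly_in)) !(rmorphM (map_poly poly_in)) /= ?map_polyC ?map_polyXn ?map_polyX /=.
rewrite !(hornerD, hornerM, hornerC, hornerX) -[z * z]expr2.
have C0' : poly_in C != 0 by rewrite -(rmorph0 poly_in) (inj_eq poly_in_inj).
rewrite zE /elt !(rmorphB, rmorphD, rmorphN, rmorphM, rmorphXn) /= -root_sqr mulNr.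
exact: quadratic_equation.
Qed.

(** The coordinates are already regular on the chart, and the one of index 0 is 1, a unit in every
    local ring; no rescaling is required. *)
Lemma cover_map_morphism : morphism_to_proj cover_map.
Proof.
move=> g p; rewrite inE => /eqP -> [pA [p0 np1] _ pM _]; exists 1.
have A1 : gen_alg const_in cover_gens 1 by rewrite -(rmorph1 const_in); apply: gen_alg_const.
split; first exact: oner_neq0.
  move=> k; rewrite mul1r; exists (cover_map k), 1; split=> //; first exact: cover_map_alg.
  by rewrite divr1.
exists ord0; rewrite mul1r cover_map0 => -[a [b [[_ pa] _ npb ab]]].
have b0 : b != 0 by apply/eqP => b0; apply: npb; rewrite b0.
by apply: npb; rewrite -[b]mul1r ab divfK.
Qed.

Lemma cover_map_dominant : dominant_to_proj cover_map.
Proof.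
move=> d G Gd G0; rewrite cover_mapE -(rmorph0 poly_in) (inj_eq poly_in_inj).
by apply: contraNneq G0 => dG0; rewrite (dehom_inj Gd dG0).
Qed.

Lemma cover_pullbackP z :
  pullback_field cover_map z <-> exists c, z = frac_in c.
Proof.
split.
  move=> [d [G [H [_ _ _ ->]]]]; exists (tofrac (dehom G) / tofrac (dehom H)).
  by rewrite !cover_mapE fmorph_div.
case=> c ->; have [n [d [d0 ->]]] := fraction_numden c.
have [G Gh dG] := exists_homogenization (leq_maxl (msize n) (msize d)).
have [H Hh dH] := exists_homogenization (leq_maxr (msize n) (msize d)).
exists (maxn (msize n) (msize d)), G, H; rewrite !cover_mapE dG dH; split=> //.
  by rewrite -(rmorph0 poly_in) (inj_eq poly_in_inj).
by rewrite fmorph_div.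
Qed.

Lemma cover_map_degree : ext_degree (pullback_field cover_map) 2.
Proof.
exists (fun i : 'I_2 => if i == ord0 then 1 else y); split.
  move=> z; have [u [v zE]] := L_gen z.
  exists (fun i : 'I_2 => if i == ord0 then frac_in u else frac_in v).
    by move=> i; apply/cover_pullbackP; case: ifP => _; eexists.
  by rewrite big_ord_recl big_ord1 /= mulr1.
move=> c cF; have /fin_all_exists[d dE] := fun i => (cover_pullbackP (c i)).1 (cF i).
rewrite big_ord_recl big_ord1 /= mulr1 !dE => /L_free[d0 d1].
move=> i; rewrite dE; case: (unliftP ord0 i) => [j ->|->]; last by rewrite d0 rmorph0.
by rewrite (ord1 j) d1 rmorph0.
Qed.

Lemma double_cover_piece : cover_piece (image_of_rational_points cover_map).
Proof.
exists double_cover, cover_map; split=> //.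
- exact: double_cover_dim.
- exact: cover_map_morphism.
- exact: cover_map_dominant.
- by exists 2%N => //; apply: cover_map_degree.
Qed.

Section RationalPoint.
Variables (xi : 'I_N -> K) (eta : K).
Hypothesis on_cover : eta ^+ 2 = D.@[xi].

Definition point_value (P Q : {mpoly K[N]}) : K := P.@[xi] + Q.@[xi] * eta.

(** The kernel of evaluation at the point (xi, eta) of the cover. Evaluation is well defined because
    the presentation [elt P Q] is unique. *)
Definition point_ideal (z : L) : Prop :=
  exists P Q, z = elt P Q /\ point_value P Q = 0.

Lemma point_valueD P Q P' Q' :
  point_value (P + P') (Q + Q') = point_value P Q + point_value P' Q'.
Proof. by rewrite /point_value !mevalD; ring. Qed.

Lemma point_valueM P Q P' Q' :
  point_value (P * P' + D * (Q * Q')) (P * Q' + Q * P') =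
  point_value P Q * point_value P' Q'.
Proof. by rewrite /point_value !(mevalD, mevalM) -on_cover; ring. Qed.

Lemma point_idealE P Q : point_ideal (elt P Q) <-> point_value P Q = 0.
Proof.
split; last by exists P, Q.
by case=> P' [Q' [/elt_inj[-> ->]]].
Qed.

Lemma point_ideal_prime : prime_of (gen_alg const_in cover_gens) point_ideal.
Proof.
split.
- by move=> _ [P [Q [-> _]]]; apply/cover_algP; exists P, Q.
- split.
    have -> : 0 = elt 0 0 by rewrite elt_const rmorph0.
    by apply/point_idealE; rewrite /point_value !meval0 mul0r addr0.
  have -> : 1 = elt 1 0 by rewrite elt_const rmorph1.
  move/point_idealE/eqP; rewrite /point_value meval0 meval1 mul0r addr0.
  by rewrite oner_eq0.
- move=> _ _ [P [Q [-> PQ]]] [P' [Q' [-> PQ']]]; rewrite eltD.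
  by apply/point_idealE; rewrite point_valueD PQ PQ' addr0.
- move=> _ _ /cover_algP[P [Q ->]] [P' [Q' [-> PQ']]]; rewrite eltM.
  by apply/point_idealE; rewrite point_valueM PQ' mulr0.
- move=> _ _ /cover_algP[P [Q ->]] /cover_algP[P' [Q' ->]]; rewrite eltM.
  move/point_idealE/eqP; rewrite point_valueM mulf_eq0.
  by case/orP => /eqP /point_idealE; [left | right].
Qed.

Lemma point_ideal_rational :
  rational_prime const_in (gen_alg const_in cover_gens) point_ideal.
Proof.
move=> _ /cover_algP[P [Q ->]]; exists (point_value P Q).
have -> : elt P Q - const_in (point_value P Q) = elt (P - (point_value P Q)%:MP) Q.
  by rewrite /elt rmorphB /= /const_in; ring.
apply/point_idealE; rewrite {1}/point_value mevalB mevalC /point_value; ring.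
Qed.

Lemma point_image (v : 'rV[K]_N.+1) :
  v 0 ord0 != 0 -> (forall j, v 0 (lift ord0 j) = v 0 ord0 * xi j) ->
  image_of_rational_points cover_map v.
Proof.
move=> v0 vxi; exists cover_gens, point_ideal; split.
- by rewrite inE.
- exact: point_ideal_prime.
- exact: point_ideal_rational.
exists (const_in (v 0 ord0)); first by rewrite fmorph_eq0.
move=> k; set z := _ - _.
have pz : point_ideal z.
  rewrite /z; case: (unliftP ord0 k) => [j ->|->]; last first.
    rewrite cover_map0 mulr1 subrr; exists 0, 0; rewrite elt_const rmorph0.
    by rewrite /point_value !meval0 mul0r addr0.
  have -> : const_in (v 0 ord0) * cover_map (lift ord0 j) -
      vin double_cover (v 0 (lift ord0 j)) =
      elt ((v 0 ord0)%:MP * 'X_j - (v 0 (lift ord0 j))%:MP) 0.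
    by rewrite elt_const rmorphB rmorphM /= /cover_map /affine_coord liftK.
  apply/point_idealE; rewrite /point_value mevalB mevalM !mevalC mevalXU ?meval0.
  by rewrite vxi mul0r addr0 subrr.
have [pA [_ np1] _ _ _] := point_ideal_prime.
exists z, 1; split=> //; last by rewrite divr1.
  by split=> //; apply: pA.
by rewrite -(rmorph1 const_in); apply: gen_alg_const.
Qed.

End RationalPoint.
End DoubleCover.

(** * Darmon points *)

Section Valuation.
Variables (K : fieldType) (v : dvaluation K).

Lemma val_geD r x y : val_ge v r x -> val_ge v r y -> val_ge v r (x + y).
Proof.
move=> [->|rx] [->|ry]; rewrite ?addr0 ?add0r; try by [left | right].
have [->|x0] := eqVneq x 0; first by rewrite add0r; right.
have [->|y0] := eqVneq y 0; first by rewrite addr0; right.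
have [->|xy0] := eqVneq (x + y) 0; first by left.
by right; apply: le_trans (dvalD v x0 y0 xy0); rewrite le_min rx.
Qed.

Lemma val_geM r s x y : val_ge v r x -> val_ge v s y -> val_ge v (r + s) (x * y).
Proof.
move=> [->|rx] [->|sy]; rewrite ?mul0r ?mulr0; try by left.
have [->|x0] := eqVneq x 0; first by rewrite mul0r; left.
have [->|y0] := eqVneq y 0; first by rewrite mulr0; left.
by right; rewrite dvalM // lerD.
Qed.

Lemma val_ge_sum r (I : Type) (s : seq I) (P : pred I) (g : I -> K) :
  (forall i, P i -> val_ge v r (g i)) -> val_ge v r (\sum_(i <- s | P i) g i).
Proof. by move=> gr; apply: big_ind => //; [left | apply: val_geD]. Qed.

Lemma in_Ov1 : in_Ov v 1. Proof. by right; rewrite dval1. Qed.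

Lemma in_OvD x y : in_Ov v x -> in_Ov v y -> in_Ov v (x + y).
Proof. exact: val_geD. Qed.

Lemma in_OvM x y : in_Ov v x -> in_Ov v y -> in_Ov v (x * y).
Proof. by move=> xO yO; have := val_geM xO yO; rewrite addr0. Qed.

Lemma in_OvX x k : in_Ov v x -> in_Ov v (x ^+ k).
Proof.
move=> xO; elim: k => [|k IH]; first by rewrite expr0; apply: in_Ov1.
by rewrite exprS; apply: in_OvM.
Qed.

Lemma in_OvN x : in_Ov v x -> in_Ov v (- x).
Proof.
rewrite -mulN1r; apply: in_OvM; right.
have N10 : (-1 : K) != 0 by rewrite oppr_eq0 oner_neq0.
have := dvalX v 2 N10; rewrite sqrrN expr1n dval1; lia.
Qed.

Lemma in_Ov_int (z : int) : in_Ov v (z%:~R).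
Proof.
have nat_in (k : nat) : in_Ov v k%:R.
  elim: k => [|k IH]; first by left.
  by rewrite -addn1 natrD; apply: in_OvD => //; apply: in_Ov1.
case: z => k; first exact: nat_in.
by rewrite NegzE rmorphN; apply: in_OvN; apply: nat_in.
Qed.

Lemma in_Ov_dval x : x != 0 -> in_Ov v x -> 0 <= dval v x.
Proof. by move=> x0 [x0'|//]; rewrite x0' eqxx in x0. Qed.

(** If v(x) < 0, the lower terms of a monic equation of degree n have valuation at least (n-1) v(x),
    which exceeds n v(x), so they cannot cancel x^n. *)
Lemma alg_integer_in_Ov x : alg_integer x -> in_Ov v x.
Proof.
case=> p mon_p /rootP px; have [->|x0] := eqVneq x 0; first by left.
right; rewrite leNgt; apply/negP => vx.
have mon_pK : map_poly (intr : int -> K) p \is monic by apply: monic_map.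
set q := map_poly _ p in px mon_pK.
have q_int i : in_Ov v q`_i.
  by rewrite coef_map; apply: in_Ov_int.
have sq : size q = (size q).-1.+1 by rewrite prednK // lt0n size_poly_eq0 monic_neq0.
have := px; rewrite horner_coef sq big_ord_recr /= -lead_coefE (monicP mon_pK) mul1r.
set n := (size q).-1; move/eqP; rewrite addr_eq0 => /eqP sum_eq.
have n_gt0 : (0 < n)%N.
  rewrite lt0n; apply/eqP => n0; move: sum_eq; rewrite n0 big_ord0 expr0 => /eqP.
  by rewrite eq_sym oppr_eq0 oner_eq0.
have : val_ge v ((n%:Z - 1) * dval v x) (- x ^+ n).
  rewrite -sum_eq; apply: val_ge_sum => i _.
  rewrite -[_ * dval v x]add0r; apply: val_geM; first exact: q_int.
  right; rewrite dvalX //; have := ltn_ord i; nia.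
case=> [/eqP|]; first by rewrite oppr_eq0 expf_eq0 (negbTE x0) andbF.
have xn0 : x ^+ n != 0 by rewrite expf_neq0.
have -> : dval v (- x ^+ n) = n%:Z * dval v x.
  have N10 : (-1 : K) != 0 by rewrite oppr_eq0 oner_neq0.
  have vN1 : dval v (-1) = 0 by have := dvalX v 2 N10; rewrite sqrrN expr1n dval1; lia.
  by rewrite -mulN1r dvalM // vN1 add0r dvalX.
nia.
Qed.

Lemma in_Ov_div x y : y != 0 -> dval v y = 0 -> in_Ov v (x * y) -> in_Ov v x.
Proof.
move=> y0 vy [/eqP|]; first by rewrite mulf_eq0 (negbTE y0) orbF => /eqP ->; left.
have [->|x0] := eqVneq x 0; first by left.
by rewrite dvalM // vy addr0; right.
Qed.

Lemma in_Ov_meval n (p : {mpoly K[n]}) (x : 'I_n -> K) :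
  (forall m, in_Ov v p@_m) -> (forall i, in_Ov v (x i)) -> in_Ov v p.@[x].
Proof.
move=> pO xO; rewrite mevalE; apply: val_ge_sum => m _; apply: in_OvM => //.
apply: big_ind => [||i _]; [exact: in_Ov1 | exact: in_OvM | exact: in_OvX].
Qed.

(** Gauss's lemma for a unit leading coefficient: the leading coefficient of q is that of q f
    divided by that of f, so the leading term of q can be split off, leaving fewer monomials. *)
Lemma in_Ov_quotient n (f : {mpoly K[n]}) :
  f != 0 -> dval v (mleadc f) = 0 -> (forall m, in_Ov v f@_m) ->
  forall q : {mpoly K[n]}, (forall m, in_Ov v (q * f)@_m) -> forall m, in_Ov v q@_m.
Proof.
move=> f0 vf fO q; have [k] := ubnP (size (msupp q)).
elim: k q => // k IH q ltk qfO m.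
have [->|q0] := eqVneq q 0; first by rewrite mcoeff0; left.
have lead_q : in_Ov v (mleadc q).
  apply: (@in_Ov_div _ (mleadc f)); rewrite ?mleadc_eq0 //.
  by rewrite -mleadcM; apply: qfO.
pose q' := q - mleadc q *: 'X_[mlead q].
have q'O m' : in_Ov v q'@_m'.
  apply: IH => [|m''].
    rewrite (perm_size (msupp_rem q (mlead q))) size_rem ?mlead_supp //.
    by have := mlead_supp q0; case: (msupp q) ltk.
  rewrite mulrBl mcoeffB; apply: in_OvD => //; apply: in_OvN.
  rewrite -scalerAl mcoeffZ; apply: in_OvM => //.
  rewrite mcoeffM; apply: val_ge_sum => l _; apply: in_OvM => //.
  by rewrite mcoeffX; apply: (in_Ov_int (Posz (mlead q == l.1)%N)).
have -> : q = q' + mleadc q *: 'X_[mlead q] by rewrite subrK.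
rewrite mcoeffD mcoeffZ mcoeffX; apply: in_OvD => //; apply: in_OvM => //.
exact: (in_Ov_int (Posz (mlead q == m)%N)).
Qed.
End Valuation.

Lemma halve_sum (k l : int) (i : nat) :
  2%:Z * k + l = (i + i)%N -> l = i%:Z - k + (i%:Z - k).
Proof. lia. Qed.

(** * Good places and the parity of valuations at Darmon points *)

Section GoodPlaces.
Variable K : fieldExtType rat.
Implicit Types (v : dvaluation K) (N : int).

Lemma dval_int_ge0 v N : N != 0 -> 0 <= dval v N%:~R.
Proof. by move=> N0; apply: in_Ov_dval; [rewrite numfield_intr_eq0 | apply: in_Ov_int]. Qed.

Lemma dval_intM v M N : M != 0 -> N != 0 -> dval v (M * N)%:~R = 0 ->
  dval v M%:~R = 0 /\ dval v N%:~R = 0.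
Proof.
move=> M0 N0; have := dval_int_ge0 v M0; have := dval_int_ge0 v N0.
rewrite rmorphM dvalM ?numfield_intr_eq0 //.
by move: (dval v _) (dval v _) => k l; lia.
Qed.

(** Take x with v(x) = 1 and h x integral. A nonzero integer N with N/(h x) integral satisfies v(N)
    >= v(h) + 1. *)
Lemma exists_int_dval_gt0 v : exists2 N, N != 0 & 0 < dval v N%:~R.
Proof.
have [x x0 vx] := dval_normalised v.
have [h h0 hO] := alg_integer_scale x.
have hK : (h%:~R : K) != 0 by rewrite numfield_intr_eq0.
have [N N0 NO] := alg_integer_scale (h%:~R * x)^-1.
have NK : (N%:~R : K) != 0 by rewrite numfield_intr_eq0.
have o0 : h%:~R * x != 0 by rewrite mulf_neq0.
exists N => //.
have := in_Ov_dval (mulf_neq0 NK (invr_neq0 o0)) (alg_integer_in_Ov v NO).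
rewrite dvalM ?invr_neq0 // dvalV // dvalM // vx.
by have := dval_int_ge0 v h0; move: (dval v _) (dval v _) => k l; lia.
Qed.

Lemma exists_int_avoiding_places (S : seq (place K)) : exists2 N, N != 0 &
  forall v, dval v N%:~R = 0 -> ~ in_places (FinitePlace v) S.
Proof.
elim: S => [|p S [N N0 NS]]; first by exists 1 => // v _ /List.Exists_nil.
have [M M0 Mp] : exists2 M, M != 0 & forall v, dval v M%:~R = 0 -> ~ same_place (FinitePlace v) p.
  case: p => [w|s]; last by exists 1 => // v _ [].  
  have [M M0 wM] := exists_int_dval_gt0 w; exists M => // v vM same.
  by move: wM; rewrite -same ?numfield_intr_eq0 // vM ltxx.
exists (M * N); first exact: mulf_neq0.
move=> v /(dval_intM M0 N0)[vM vN] /List.Exists_cons[]; first exact: Mp.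
exact: NS.
Qed.

Lemma exists_common_denominator (s : seq K) : exists2 N, N != 0 &
  forall c, c \in s -> alg_integer (N%:~R * c).
Proof.
elim: s => [|c s [N N0 sN]]; first by exists 1.
have [M M0 cM] := alg_integer_scale c; exists (M * N); first exact: mulf_neq0.
move=> d; rewrite inE rmorphM /= => /orP[/eqP ->|ds].
  by rewrite mulrAC mulrC; apply: alg_integerM => //; apply: alg_integer_int.
by rewrite -mulrA; apply: alg_integerM; [apply: alg_integer_int | apply: sN].
Qed.

(** N is a product of three factors: N1 excludes the places of S, h clears the denominators of f,
    and N2 does so for the inverse of its leading coefficient. When v(N) = 0, the intersection ideal
    at primitive coordinates c x is generated by f(c x), so r = 2 v(c) + v(f(x)), and r is even as a
    multiple of m. *)
Lemma darmon_selmer n (f : {mpoly K[n.+1]}) (S : seq (place K)) m :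
  f \is 2.-homog -> ~~ odd m -> exists2 N, N != 0 &
  forall x, darmon_point S f m x -> f.@[x 0] != 0 -> selmer N f.@[x 0].
Proof.
move=> f2 m_even; have [a fE] := exists_quad_form f2.
have [f0|f0] := eqVneq f 0; first by exists 1 => // x _; rewrite f0 meval0 eqxx.
have [N1 N10 avoidS] := exists_int_avoiding_places S.
have [h h0 hf] := exists_common_denominator [seq f@_k | k <- msupp f].
have [N2 N20 lead_int] := alg_integer_scale (mleadc f)^-1.
have hK : (h%:~R : K) != 0 by rewrite numfield_intr_eq0.
exists (N1 * (h * N2)); first by rewrite !mulf_neq0.
move=> x [_ darmon_x] fx0; split=> // v.
move=> /(dval_intM N10 (mulf_neq0 h0 N20))[vN1 /(dval_intM h0 N20)[vh vN2]].
have hfO k : alg_integer (h%:~R * f@_k).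
  have [kf|/memN_msupp_eq0 ->] := boolP (k \in msupp f); first by apply: hf; apply: map_f.
  by rewrite mulr0; apply: (alg_integer_int K 0).
have fO k : in_Ov v f@_k.
  by apply: (in_Ov_div hK vh); rewrite mulrC; apply: alg_integer_in_Ov.
have lf0 : mleadc f != 0 by rewrite mleadc_eq0.
have vlead : dval v (mleadc f) = 0.
  have ge0 := in_Ov_dval lf0 (fO _).
  have N2K : (N2%:~R : K) != 0 by rewrite numfield_intr_eq0.
  have := in_Ov_dval (mulf_neq0 N2K (invr_neq0 lf0)) (alg_integer_in_Ov v lead_int).
  rewrite dvalM ?invr_neq0 // dvalV // vN2; lia.
have [[r|] /= fr mr] := darmon_x v (avoidS v vN1); last by rewrite fr eqxx in fx0.
case: fr => _ [c [pi [c0 [cxO _] [pi0 vpi] idealE]]].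
have fcx : f.@[(c *: x) 0] = c ^+ 2 * f.@[x 0].
  rewrite fE !quad_formE mulr_sumr; apply: eq_bigr => i _.
  by rewrite mulr_sumr; apply: eq_bigr => j _; rewrite !mxE; ring.
have fcx0 : f.@[(c *: x) 0] != 0 by rewrite fcx mulf_neq0 ?expf_neq0.
have pir0 : pi ^+ r != 0 by rewrite expf_neq0.
have vpir : dval v (pi ^+ r) = r%:Z by rewrite dvalX // vpi mulr1.
(* The form h f has coefficients in O, so it belongs to the ideal of the closure, and h is a unit at
   v. *)
have ge_r : r%:Z <= dval v f.@[(c *: x) 0].
  have [|b bO] := (idealE (h%:~R * f.@[(c *: x) 0])).1.
    exists [:: (1, h%:~R *: f)]; split; last by rewrite big_seq1 /= mul1r mevalZ.
    apply: List.Forall_cons => //; split; first exact: in_Ov1.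
    exists 2%N; split; first exact: rpredZ.
      by move=> k w _; rewrite mcoeffZ; apply: alg_integer_in_Ov.
    by exists (h%:~R%:MP); rewrite mul_mpolyC.
  move=> hfb; have b0 : b != 0.
    by apply: contraNneq (mulf_neq0 hK fcx0) => b0; rewrite hfb b0 mul0r.
  have := congr1 (dval v) hfb; rewrite !dvalM // vpir vh add0r => ->.
  by rewrite lerDr; apply: in_Ov_dval.
(* Every form in the ideal of the closure is q f with q over the valuation ring, by
   [in_Ov_quotient], so its value at c x is a multiple of f(c x). *)
have le_r : dval v f.@[(c *: x) 0] <= r%:Z.
  rewrite -vpir.
  have [|s [sO pirE]] := (idealE (pi ^+ r)).2.
    by exists 1; [apply: in_Ov1 | rewrite mul1r].
  have [pir0'|//] : val_ge v (dval v f.@[(c *: x) 0]) (pi ^+ r).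
    rewrite pirE; elim: s sO {pirE} => [|[u g] s IH] sO; first by rewrite big_nil; left.
    rewrite big_cons; have /= [uO [d [_ gO [q gE]]]] := List.Forall_inv sO.
    have sO' := List.Forall_inv_tail sO.
    apply: val_geD; last exact: IH.
    have qO : in_Ov v q.@[(c *: x) 0].
      apply: in_Ov_meval; last exact: cxO.
      apply: (in_Ov_quotient f0 vlead fO) => k.
      by rewrite -gE; apply: gO; apply: avoidS.
    rewrite gE mevalM mulrA -[dval v _]add0r; apply: val_geM; last by right.
    exact: in_OvM.
  by rewrite pir0' eqxx in pir0.
have vfcx : dval v f.@[(c *: x) 0] = r%:Z by apply/eqP; rewrite eq_le le_r ge_r.
move: vfcx; rewrite fcx dvalM ?expf_neq0 // dvalX // => vf.
have r_even : ~~ odd r by apply: contra m_even => r_odd; apply: dvdn_odd mr r_odd.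
have rE : r = (r./2 + r./2)%N by rewrite addnn -[LHS]odd_double_half (negbTE r_even).
by exists (r./2%:Z - dval v c); apply: halve_sum; rewrite vf {1}rE.
Qed.
End GoodPlaces.

(** * Covers attached to square classes, and thinness *)

Lemma numfield_natS_neq0 (K : fieldExtType rat) k : k.+1%:R != 0 :> K.
Proof. by have := numfield_intr_eq0 K (Posz k.+1); rewrite -pmulrn => ->. Qed.

(** The cover is y^2 = f(1, X)/b over the affine chart; a point with f(x) = b c^2 is the image of
    the point with y = c/x_0. *)
Lemma quadratic_cover (K : fieldExtType rat) n (f : {mpoly K[n.+2]}) b :
  smooth_quadric f -> b != 0 ->
  exists Z, cover_piece Z /\ forall x : 'rV[K]_n.+2, x 0 ord0 != 0 ->
    (exists c, f.@[x 0] = b * c ^+ 2) -> Z x.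
Proof.
move=> f_smooth b0; pose D := b^-1 *: dehom f.
have nsqD (z : {fraction {mpoly K[n.+1]}}) : z ^+ 2 != tofrac D.
  have [p [q [q0 ->]]] := fraction_numden z.
  rewrite exprMn exprVn; apply/eqP => /(canRL (mulfVK _)); rewrite expf_neq0 ?tofrac_eq0 //.
  move=> /(_ isT)/eqP; rewrite -!tofracXn -tofracM tofrac_eq => /eqP eq_pq.
  set e := maxn (msize p) (msize q).
  (* The degree of P is one more than that of Q, so f Q^2 and b P^2 are both homogeneous of degree
     2e + 2 and can be compared after dehomogenization. *)
  have [P Ph dP] := @exists_homogenization K n.+1 p e.+1 (leqW (leq_maxl _ _)).
  have [Q Qh dQ] := @exists_homogenization K n.+1 q e (leq_maxr _ _).
  have Q0 : Q != 0 by apply: contraNneq q0 => Q0; rewrite -dQ Q0 /dehom mmap0.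
  have := smooth_quadric_not_square P (@numfield_natS_neq0 K) f_smooth b0 Q0.
  rewrite -subr_eq0 => /eqP[]; apply: (@dehom_inj _ _ (2 + e * 2)).
    apply: rpredB; first by apply: dhomogM; [case: f_smooth | apply: dhomogMn].
    by apply: rpredZ; rewrite -[(2 + _)%N]/(e.+1 * 2)%N; apply: dhomogMn.
  rewrite rmorphB rmorphM !rmorphXn /= dQ -mul_mpolyC rmorphM rmorphXn /= dP eq_pq.
  rewrite /dehom mmapC -/(dehom f) mul_mpolyC /D -scalerAl scalerA divff // scale1r.
  by rewrite subrr.
have gen z : exists a c, z = quad_const nsqD a + quad_const nsqD c * quad_root nsqD.
  by exists z.1, z.2; apply: quad_decomp.
have free a c : quad_const nsqD a + quad_const nsqD c * quad_root nsqD = 0 -> a = 0 /\ c = 0.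
  have -> : quad_const nsqD a + quad_const nsqD c * quad_root nsqD = (a, c).
    by apply: quad_eq => /=; ring.
  by case.
eexists; split; first exact: (double_cover_piece (quad_root_sqr nsqD) gen free).
move=> x x0 [c fx].
have [a fE] := exists_quad_form f_smooth.1.
pose xi j := x 0 (lift ord0 j) / x 0 ord0.
apply: (@point_image _ _ _ _ _ _ (quad_root_sqr nsqD) gen free xi (c / x 0 ord0)) => //.
  have Dxi : D.@[xi] = b^-1 * f.@[affine_coord xi].
    by rewrite /D mevalZ; congr (_ * _); rewrite /meval mmap_dehom.
  have fxi : f.@[x 0] = x 0 ord0 ^+ 2 * f.@[affine_coord xi].
    have xE i : x 0 i = x 0 ord0 * affine_coord xi i.
      rewrite /affine_coord; case: unliftP => [j ->|->]; last by rewrite mulr1.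
      by rewrite /xi mulrC divfK.
    rewrite fE !quad_formE mulr_sumr; apply: eq_bigr => i _.
    rewrite mulr_sumr; apply: eq_bigr => j _; rewrite (xE i) (xE j); ring.
  have fxi' : f.@[affine_coord xi] = f.@[x 0] / x 0 ord0 ^+ 2.
    by rewrite fxi mulrC mulKf ?expf_neq0.
  by rewrite Dxi fxi' fx; field; rewrite x0 b0.
by move=> j; rewrite /xi mulrC divfK.
Qed.

Lemma hypersurface_piece (K : fieldType) n (h : {mpoly K[n.+1]}) d :
  h \is d.-homog -> h != 0 -> proper_closed_piece (fun x : 'rV[K]_n.+1 => h.@[x 0] = 0).
Proof.
move=> h_homog h0; exists [:: h]; split.
- by move=> g; rewrite inE => /eqP ->; exists d.
- by exists h; rewrite ?inE.
- by move=> x _; split=> [hx g|]; [rewrite inE => /eqP -> | apply; rewrite inE].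
Qed.

Lemma Forall_map (A : eqType) B (P : B -> Prop) (g : A -> B) (s : seq A) :
  (forall a, a \in s -> P (g a)) -> List.Forall P (map g s).
Proof.
elim: s => [|a s IH] Ps /=; first exact: List.Forall_nil.
apply: List.Forall_cons; first by apply: Ps; rewrite inE eqxx.
by apply: IH => b bs; apply: Ps; rewrite inE bs orbT.
Qed.

Lemma Exists_map (A : eqType) B (P : B -> Prop) (g : A -> B) (s : seq A) a :
  a \in s -> P (g a) -> List.Exists P (map g s).
Proof.
elim: s => [//|b s IH]; rewrite inE => /orP[/eqP <- Pa|as_ Pa] /=.
  exact: List.Exists_cons_hd.
by apply: List.Exists_cons_tl; apply: IH.
Qed.

Theorem proposition6p1 (K : fieldExtType rat) (n : nat)
    (f : {mpoly K[n.+2]}) (S : seq (place K)) (m : nat) :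
  smooth_quadric f ->
  contains_archimedean S ->
  (2 <= m)%N ->
  ~~ odd m ->
  thin (darmon_point S f m).
Proof.
move=> f_smooth _ _ m_even; have f2 := f_smooth.1.
have [N N0 selmerN] := darmon_selmer S f2 m_even.
have [l lE] := selmer_finite K N0.
have [Z ZE] : exists Z : K -> 'rV[K]_n.+2 -> Prop, forall b, b != 0 ->
    cover_piece (Z b) /\ forall x : 'rV[K]_n.+2, x 0 ord0 != 0 ->
      (exists c, f.@[x 0] = b * c ^+ 2) -> Z b x.
  apply: (@exists_choice_fun K _ (fun b Z => b != 0 -> cover_piece Z /\
    forall x : 'rV[K]_n.+2, x 0 ord0 != 0 ->
      (exists c, f.@[x 0] = b * c ^+ 2) -> Z x)) => b.
  (* A default value for the choice of Z; the index 0 is filtered out of the list of pieces. *)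
  have [->|b0] := eqVneq b 0; first by exists (fun _ => True).
  by have [Z ZE] := quadratic_cover f_smooth b0; exists Z.
have f0 : f != 0.
  (* The case p = 0, q = 1 of not being a constant times a square. *)
  have := smooth_quadric_not_square 0 (@numfield_natS_neq0 K) f_smooth
    (oner_neq0 K) (oner_neq0 _).
  by rewrite expr1n mulr1 expr0n scaler0.
exists [:: (fun x : 'rV[K]_n.+2 => f.@[x 0] = 0),
  (fun x : 'rV[K]_n.+2 => ('X_ord0 : {mpoly K[n.+2]}).@[x 0] = 0)
  & [seq Z b | b <- l & b != 0]]; split.
  apply: List.Forall_cons; first by left; apply: hypersurface_piece f2 f0.
  apply: List.Forall_cons.
    left; apply: (@hypersurface_piece _ _ _ 1); first by rewrite dhomogX /= mdeg1.
    by rewrite -msize_poly_eq0 mmeasureX.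
  by apply: Forall_map => b; rewrite mem_filter => /andP[/ZE[Zb _] _]; right.
move=> x _ darmon_x.
have [fx|fx] := eqVneq f.@[x 0] 0; first exact: List.Exists_cons_hd.
apply: List.Exists_cons_tl.
have [x0|x0] := eqVneq (x 0 ord0) 0.
  by apply: List.Exists_cons_hd; rewrite mevalXU.
apply: List.Exists_cons_tl.
have [b [c [bl c0 fxE]]] := lE _ (selmerN x darmon_x fx).
have b0 : b != 0 by apply: contraNneq fx => b0; rewrite fxE b0 mul0r.
apply: (Exists_map (a := b)); first by rewrite mem_filter b0.
by apply: (ZE b b0).2 => //; exists c.
Qed.
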